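(* Let $(m_n)_{n\in\mathbb{N}}$ be a sequence in $(0,\infty)$. For each $n\in\mathbb{N}$, let $(X_k^{(n)})_{k\in\mathbb{Z}_+}$ be a Galton--Watson process with inhomogeneous immigration, with offspring variables $\{\xi_{k,j}^{(n)}:k,j\in\mathbb{N}\}$ and immigration process $(Y_k^{(n)})_{k\in\mathbb{Z}_+}$, as defined in the context. Assume the following. (1) $\mathbb{E}(\xi_{1,1}^{(n)})<\infty$ for all $n\in\mathbb{N}$. (2) $\mathbb{E}(Y_k^{(n)})<\infty$ for all $k\in\mathbb{Z}_+$, $n\in\mathbb{N}$, and there exists $L\in D(\mathbb{R}_+,\mathbb{R})$ such that $\limsup_{n\to\infty}\sup_{s\in[0,t]}\mathbb{E}\big(m_n^{-1}Y^{(n)}_{\lfloor ns\rfloor}\big)\le L(t)$ for all $t\in\mathbb{R}_+$. (3) There exists an $\mathbb{R}_+$-valued stochastic process $(\mathcal{Y}_t)_{t\in\mathbb{R}_+}$ with càdlàg sample paths such that $\big(m_n^{-1}Y^{(n)}_{\lfloor nt\rfloor}\big)_{t\in\mathbb{R}_+}\stackrel{\mathcal{D}}{\longrightarrow}(\mathcal{Y}_t)_{t\in\mathbb{R}_+}$ as $n\to\infty$. (4) $\mathbb{E}\big((\xi_{1,1}^{(n)})^2\big)<\infty$ for all $n\in\mathbb{N}$, and $m_n^{-1}\operatorname{Var}(\xi_{1,1}^{(n)})\to 0$ as $n\to\infty$. (5) There exist $\gamma\in\mathbb{R}$ and $\gamma_n\in\mathbb{R}$, $n\in\mathbb{N}$,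 such that $\gamma_n\to\gamma$ as $n\to\infty$ and $\mathbb{E}(\xi_{1,1}^{(n)})=1+\frac{\gamma_n}{n}$ for all $n\in\mathbb{N}$. Then $$\left(\begin{bmatrix}m_n^{-1}Y^{(n)}_{\lfloor nt\rfloor}\\ (nm_n)^{-1}X^{(n)}_{\lfloor nt\rfloor}\end{bmatrix}\right)_{t\in\mathbb{R}_+}\stackrel{\mathcal{D}}{\longrightarrow}\left(\begin{bmatrix}\mathcal{Y}_t\\ \int_0^t e^{\gamma(t-s)}\mathcal{Y}_s\,\mathrm{d}s\end{bmatrix}\right)_{t\in\mathbb{R}_+}\qquad\text{as } n\to\infty.$$
   Context: $\mathbb{Z}_+$, $\mathbb{N}$, $\mathbb{R}_+$ denote the non-negative integers, the positive integers and the non-negative reals. A Galton--Watson process with inhomogeneous immigration: for each $n\in\mathbb{N}$, $(Y_k^{(n)})_{k\in\mathbb{Z}_+}$ is an arbitrary $\mathbb{Z}_+$-valued stochastic process (its members may be dependent and have different distributions), $\{\xi^{(n)}_{k,j}:k,j\in\mathbb{N}\}$ are independent, identically distributed $\mathbb{Z}_+$-valued random variables independent of $\{Y^{(n)}_k:k\in\mathbb{Z}_+\}$, and $X_0^{(n)}=0$, $X_k^{(n)}=\sum_{j=1}^{X^{(n)}_{k-1}}\xi^{(n)}_{k,j}+Y^{(n)}_{k-1}$ for $k\in\mathbb{N}$, with $\sum_{j=1}^0:=0$. All random variables are defined on a fixed probability space. $D(\mathbb{R}_+,\mathbb{R}^d)$ is the space of càdlàg functions (right continuous with left limits) $\mathbb{R}_+\to\mathbb{R}^d$,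 endowed with the Skorokhod $J_1$ topology (a separable, completely metrizable topology) and its Borel $\sigma$-algebra. Here $f_n\to f$ in $J_1$ iff there are continuous strictly increasing $\lambda_n:\mathbb{R}_+\to\mathbb{R}_+$ with $\lambda_n(0)=0$, $\lim_{t\to\infty}\lambda_n(t)=\infty$, $\sup_{t\in\mathbb{R}_+}|\lambda_n(t)-t|\to0$ and $\sup_{t\in[0,K]}\|f_n(\lambda_n(t))-f(t)\|\to0$ for all $K>0$. For càdlàg processes, $\stackrel{\mathcal{D}}{\longrightarrow}$ denotes weak convergence of their distributions on $D(\mathbb{R}_+,\mathbb{R}^d)$ (with $d=2$ in the conclusion). *)

(* Defs.v *)
From HB Require Import structures.
From mathcomp Require Export all_boot all_order all_algebra.
From mathcomp Require Export finmap.
From mathcomp Require Export all_classical all_reals all_analysis.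

Set Implicit Arguments.
Unset Strict Implicit.
Unset Printing Implicit Defensive.

Export Order.TTheory GRing.Theory Num.Theory.
Export numFieldNormedType.Exports.

Local Open Scope classical_set_scope.
Local Open Scope ring_scope.

(** * The Skorokhod space *)

(* Only the restriction of [f] to [0, +oo[ is constrained. *)
Definition cadlag (R : realType) (V : normedModType R) (f : R -> V) : Prop :=
  (forall t : R, 0 <= t -> f x @[x --> t^'+] --> f t) /\
  (forall t : R, 0 < t -> cvg (f x @[x --> t^'-])).

(* The set D(R_+, V).  A function on R_+ is encoded as a function on R that is
   constant on ]-oo, 0]; thus two elements that agree on R_+ are equal. *)
Record skorokhod (R : realType) (V : normedModType R) := Skorokhod {
  path :> R -> V ;
  path_cadlag : cadlag path ;
  path_neg : forall t, t < 0 -> path t = path 0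
}.

(* Time changes of R_+; values at negative arguments are irrelevant. *)
Definition time_change (R : realType) (lambda : R -> R) : Prop :=
  [/\ {within `[0, +oo[, continuous lambda},
      {in `[0, +oo[ &, {homo lambda : s t / s < t}},
      lambda 0 = 0 &
      lambda t @[t --> +oo] --> +oo].

Definition J1_cvg (R : realType) (V : normedModType R)
    (f_ : nat -> skorokhod V) (f : skorokhod V) : Prop :=
  exists lambda_ : nat -> R -> R,
    [/\ forall n, time_change (lambda_ n),
        ereal_sup [set `|lambda_ n t - t|%:E | t in `[0, +oo[%classic]
          @[n --> \oo] --> 0%E &
        forall K : R, 0 < K ->
          ereal_sup [set `|f_ n (lambda_ n t) - f t|%:E | t in `[0, K]%classic]
            @[n --> \oo] --> 0%E].

(* The J1 topology is metrizable, so that its open sets are exactly the sets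
   that are sequentially open for [J1_cvg]. *)
Definition J1_open (R : realType) (V : normedModType R)
    (U : set (skorokhod V)) : Prop :=
  forall (f_ : nat -> skorokhod V) (f : skorokhod V),
    J1_cvg f_ f -> U f -> \forall n \near \oo, U (f_ n).

Section skorokhod_topology.
Context {R : realType} {V : normedModType R}.

HB.instance Definition _ := gen_eqMixin (skorokhod V).
HB.instance Definition _ := gen_choiceMixin (skorokhod V).

Lemma cadlag_cst (c : V) : cadlag (fun _ : R => c).
Proof.
by split=> t _; [exact: cvg_cst | apply/cvg_ex; exists c; exact: cvg_cst].
Qed.

HB.instance Definition _ := isPointed.Build (skorokhod V)
  (@Skorokhod R V (fun=> 0) (cadlag_cst 0) (fun _ _ => erefl)).

Lemma J1_openT : J1_open [set: skorokhod V].
Proof. by move=> f_ f _ _; near=> n. Unshelve. all: by end_near. Qed.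

Lemma J1_openI : setI_closed (@J1_open R V).
Proof.
move=> A B oA oB f_ f ff [Af Bf].
by near=> n; split; near: n; [exact: oA ff Af | exact: oB ff Bf].
Unshelve. all: by end_near. Qed.

Lemma J1_open_bigU (I : Type) (F : I -> set (skorokhod V)) :
  (forall i, J1_open (F i)) -> J1_open (\bigcup_i F i).
Proof.
move=> oF f_ f ff [i _ Fif].
by near=> n; exists i => //; near: n; exact: oF ff Fif.
Unshelve. all: by end_near. Qed.

HB.instance Definition _ := isOpenTopological.Build (skorokhod V)
  J1_openT J1_openI J1_open_bigU.

End skorokhod_topology.

(** * Weak convergence *)

Notation borel S := (g_sigma_algebraType (@open S)).

Definition weak_cvg (R : realType) (S : ptopologicalType)
    (mu_ : nat -> probability (borel S) R) (mu : probability (borel S) R) :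
    Prop :=
  forall F : S -> R, continuous F -> (exists M : R, forall x, `|F x| <= M) ->
    (\int[mu_ n]_x (F x)%:E)%E @[n --> \oo] --> (\int[mu]_x (F x)%:E)%E.

(* The process [Z], indexed by t >= 0, has cadlag paths and, seen as a map into
   the Skorokhod space, is the (necessarily unique) random element [X]. *)
Definition is_path_of (R : realType) (V : normedModType R) (Omega : Type)
    (X : Omega -> skorokhod V) (Z : R -> Omega -> V) : Prop :=
  forall w t, 0 <= t -> X w t = Z t w.

(* The sequence is indexed by n >= 1; [Z_ 0] plays no role. *)
Definition cvg_in_law d (Omega : measurableType d) (R : realType)
    (P : probability Omega R) (V : normedModType R)
    (Z_ : nat -> R -> Omega -> V) (Z : R -> Omega -> V) : Prop :=
  exists (X_ : nat -> {RV P >-> borel (skorokhod V)})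
         (X : {RV P >-> borel (skorokhod V)}),
    [/\ forall n, (0 < n)%N -> is_path_of (X_ n) (Z_ n),
        is_path_of X Z &
        weak_cvg (fun n => distribution P (X_ n)) (distribution P X)].

(** * Independence *)

Definition mutually_independent d (Omega : measurableType d) (R : realType)
    (P : probability Omega R) d' (S : measurableType d') (I : choiceType)
    (D : set I) (X : I -> {RV P >-> S}) : Prop :=
  forall (J : {fset I}) (A : I -> set S),
    (forall i, i \in J -> D i) -> (forall i, measurable (A i)) ->
    P (\bigcap_(i in [set` J]) (X i @^-1` A i)) =
      (\prod_(i <- J) P (X i @^-1` A i))%E.

Definition sigma_of d (Omega : measurableType d) (R : realType)
    (P : probability Omega R) d' (S : measurableType d') (I : Type)
    (D : set I) (X : I -> {RV P >-> S}) : set (set Omega) :=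
  <<s [set X i @^-1` A | i in D & A in measurable] >>.

Definition independent_families d (Omega : measurableType d) (R : realType)
    (P : probability Omega R) d' (S : measurableType d') (I I' : Type)
    (D : set I) (X : I -> {RV P >-> S})
    (D' : set I') (Y : I' -> {RV P >-> S}) : Prop :=
  forall A B, sigma_of D X A -> sigma_of D' Y B -> P (A `&` B) = (P A * P B)%E.

(** * Galton-Watson processes with inhomogeneous immigration *)

(* The offspring variables [xi k j] are indexed by k, j >= 1; the variables with
   k = 0 or j = 0 play no role. *)
Definition GW_immigration d (Omega : measurableType d) (R : realType)
    (P : probability Omega R) (xi : nat -> nat -> {RV P >-> nat})
    (Y : nat -> {RV P >-> nat}) (X : nat -> Omega -> nat) : Prop :=
  let D := [set kj : nat * nat | (0 < kj.1)%N && (0 < kj.2)%N] in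
  let xi2 := fun kj : nat * nat => xi kj.1 kj.2 in
  [/\ forall k j A, (0 < k)%N -> (0 < j)%N ->
        distribution P (xi k j) A = distribution P (xi 1%N 1%N) A,
      mutually_independent D xi2,
      independent_families D xi2 setT Y,
      forall w, X 0%N w = 0%N &
      forall k w, (0 < k)%N ->
        X k w = (\sum_(1 <= j < (X k.-1 w).+1) xi k j w + Y k.-1 w)%N].

Definition colvec2 (R : realType) (a b : R) : 'cV[R]_2 :=
  \col_i (if i == ord0 then a else b).

(* Main.v *)
(* Let Phi f = (f, conv f) with conv f t = int_0^t e^(gamma (t - s)) f s ds; it
   maps D(R_+, R) continuously to D(R_+, R^2), so that Phi of the scaled
   immigration path converges in law to Phi(Y).  It remains to show that the
   scaled population is uniformly close to conv of the scaled immigration on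
   [0, K], in probability.

   Write a = 1 + gamma_n / n.  The population X minus the solution Z of
   Z_(k+1) = a Z_k + Y_k is a^k times a martingale with increments
   a^-k sum_(j <= X_(k-1)) (xi_(k,j) - a).  Stopping this martingale when it
   exceeds a level and applying Chebyshev's inequality to its second moment
   yields Doob's maximal inequality; the second moment is of order n^2 m_n Var xi,
   negligible with respect to (n m_n)^2.  Instead of conditional expectations,
   each offspring variable is integrated out against the information revealed
   before it, by uniqueness of product measures and Tonelli's theorem.
   On the event that the scaled immigration stays below A on [0, K], whose
   probability is close to 1 by tightness, Z is compared with conv by a
   deterministic recursion.

   Weak convergence is transferred from Phi of the immigration to the pair by
   means of a distance inducing J1: a bounded continuous F is an increasing limit
   of the inf-convolutions F_k f = inf_g F g + k d(g, f), which are Lipschitz. *)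

(* The topology of the Skorokhod space is known only through its convergent sequences, and [J1_dist]
   comes with a triangle inequality but no symmetry. This suffices because J1 convergence sends both
   [J1_dist (f_ n) f] and [J1_dist f (f_ n)] to 0. Inf-convolutions replace metric-space theory
   three times: in the transfer of weak convergence, in the measurability of path-valued maps and in
   the tightness bound for the immigration. The probabilistic obstacle is that Y is controlled only
   through its means and its limit in law. The bound on the means gives E X_k = O(n m_n), which
   controls the accumulated offspring variance; comparing Z with conv requires a bound on the whole
   immigration path, available only with high probability. Since Y may be dependent in any way, all
   of it, future included, counts as known when an offspring variable is integrated out. A
   generation has random size, so its sum is truncated at j terms and the limit is taken by Fatou's
   lemma; this is why the moment estimates are inequalities. *)
Require Import Defs.
From mathcomp Require Import measurable_realfun ring lra.
Set Implicit Arguments.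
Unset Strict Implicit.
Unset Printing Implicit Defensive.
Local Open Scope classical_set_scope.
Local Open Scope ring_scope.

(** * A distance for the J1 topology *)

Section time_changes.
Context {R : realType}.
Implicit Types (l : R -> R) (s t : R).

Lemma time_change_lt l s t : time_change l -> 0 <= s -> s < t -> l s < l t.
Proof.
move=> [_ h _ _] s0 st; apply: h => //; rewrite in_itv/= andbT//.
by rewrite (le_trans s0) ?ltW.
Qed.

Lemma time_change_le l s t : time_change l -> 0 <= s -> s <= t -> l s <= l t.
Proof.
move=> hl s0; rewrite le_eqVlt => /predU1P[->//|st].
exact/ltW/time_change_lt.
Qed.

Lemma time_change_ge0 l t : time_change l -> 0 <= t -> 0 <= l t.
Proof.
move=> hl t0; have [_ _ l0 _] := hl.
by rewrite -l0; exact: time_change_le.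
Qed.

Lemma time_change_surj l s : time_change l -> 0 <= s ->
  exists2 t, 0 <= t & l t = s.
Proof.
move=> [cl _ l0 linf] s0.
have [b [b0 lb]] : exists b, 0 <= b /\ s <= l b.
  move/cvgryPge : linf => /(_ s) [M [_ hM]].
  exists (Num.max 0 (M + 1)); split; first by rewrite le_max lexx.
  by apply: hM; rewrite lt_max ltrDl ltr01 orbT.
have cl' : {within `[0, b], continuous l}.
  apply: continuous_subspaceW cl => x /=; rewrite !in_itv/= => /andP[->//].
have [|c] := IVT b0 cl' (v := s).
  by rewrite l0 ge_min s0 /= le_max lb orbT.
by rewrite in_itv/= => /andP[c0 _] <-; exists c.
Qed.

(** A monotone function can be discontinuous only by skipping values, so surjectivity yields
    continuity, and also the limit at infinity. Compositions and inverses are recognised as time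
    changes through this criterion. *)
Lemma surjective_time_change l : l 0 = 0 ->
  (forall s t, 0 <= s -> s < t -> l s < l t) ->
  (forall s, 0 <= s -> exists2 t, 0 <= t & l t = s) -> time_change l.
Proof.
move=> l0 lmono lsurj.
have cont b : 0 < b -> {within `[0, b], continuous l}.
  move=> b0; apply: segment_inc_surj_continuous.
    apply: le_mono_in => x y; rewrite !in_itv/= => /andP[x0 _] _.
    exact: lmono.
  move=> y /=; rewrite l0 in_itv/= => /andP[y0 yb].
  have [t t0 lt] := lsurj _ y0; exists t => //=; rewrite in_itv/= t0/=.
  rewrite leNgt; apply/negP => bt; move: yb; apply/negP; rewrite -ltNge -lt.
  by apply: lmono => //; exact: ltW.
split => //.
- apply/continuous_within_itvcyP; split.
    move=> x; rewrite in_itv/= andbT => x0.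
    apply: (within_continuous_continuous (a := 0) (b := x + 1)).
    - by rewrite addr_gt0.
    - by apply: cont; rewrite addr_gt0.
    - by rewrite in_itv/= x0 ltrDl ltr01.
  have := cont 1 ltr01; move/continuous_within_itvP => /(_ ltr01).
  by case.
- by move=> s t; rewrite !in_itv/= !andbT => s0 t0; exact: lmono.
- apply/cvgryPge => A.
  have [|t t0 lt] := lsurj (Num.max 0 A); first by rewrite le_max lexx.
  near=> x.
  apply: (@le_trans _ _ (l t)); first by rewrite lt le_max lexx orbT.
  by apply/ltW/lmono => //; near: x; apply: nbhs_pinfty_gt; exact: num_real.
Unshelve. all: by end_near. Qed.

Lemma time_change_id : time_change (@id R).
Proof. by apply: surjective_time_change => // s s0; exists s. Qed.

Lemma time_change_comp l1 l2 : time_change l1 -> time_change l2 ->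
  time_change (l1 \o l2).
Proof.
move=> h1 h2; apply: surjective_time_change => /=.
- by have [_ _ -> _] := h2; have [_ _ -> _] := h1.
- move=> s t s0 st; apply: time_change_lt => //; first exact: time_change_ge0.
  exact: time_change_lt.
- move=> s s0; have [t t0 <-] := time_change_surj h1 s0.
  by have [u u0 <-] := time_change_surj h2 t0; exists u.
Qed.

Lemma time_change_inv l : time_change l ->
  exists2 l', time_change l' & forall t, 0 <= t -> l (l' t) = t.
Proof.
move=> hl; have [_ _ l00 _] := hl.
(* The inverse is chosen pointwise; 0 is a default at negative arguments, where a time change is
   unconstrained. *)
pose l' t := if pselect (0 <= t) is left t0
             then sval (cid2 (time_change_surj hl t0)) else 0.
have l'0 t : 0 <= l' t.
  by rewrite /l'; case: pselect => //= t0; case: cid2.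
have ll' t : 0 <= t -> l (l' t) = t.
  by rewrite /l'; case: pselect => //= t0 _; case: cid2.
have inj s t : 0 <= s -> 0 <= t -> l s = l t -> s = t.
  move=> s0 t0 st; apply/eqP; case: ltgtP => //.
  - by move/(time_change_lt hl s0); rewrite st ltxx.
  - by move/(time_change_lt hl t0); rewrite st ltxx.
exists l' => //; apply: surjective_time_change.
- by apply: inj => //; rewrite ll'.
- move=> s t s0 st; rewrite ltNge; apply/negP.
  have t0 : 0 <= t by rewrite (le_trans s0)// ltW.
  by move/(time_change_le hl (l'0 t)); rewrite ll'// ll'// leNgt st.
- move=> s s0; exists (l s); first exact: time_change_ge0.
  by apply: inj => //; rewrite ll' //; exact: time_change_ge0.
Qed.

End time_changes.

(** The supremum may be [+oo] for small n, so convergence to 0 includes eventual finiteness.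
    Non-emptiness of A excludes the value [-oo]. *)
Lemma cvg_ereal_sup0P (R : realType) (T : Type) (g : nat -> T -> R) (A : set T) :
  A !=set0 -> (forall n t, 0 <= g n t) ->
  ereal_sup [set (g n t)%:E | t in A] @[n --> \oo] --> 0%E <->
  forall e, 0 < e -> \forall n \near \oo, forall t, A t -> g n t <= e.
Proof.
move=> [t0 At0] g0; pose S n := ereal_sup [set (g n t)%:E | t in A].
have S0 n : (0 <= S n)%E.
  apply: (@le_trans _ _ (g n t0)%:E); first by rewrite lee_fin.
  by apply: ereal_sup_ubound; exists t0.
split.
  move/fine_cvgP => [Sfin /cvgrPdist_le Scv] e e0.
  move: (Scv _ e0) Sfin; apply: filterS2 => n; rewrite sub0r normrN => Sn Sfin t At.
  apply: le_trans Sn; apply: le_trans (ler_norm _).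
  rewrite -lee_fin fineK//; apply: ereal_sup_ubound; by exists t.
move=> h.
have hS e : 0 < e -> \forall n \near \oo, (S n <= e%:E)%E.
  move=> /h; apply: filterS => n hn; apply: ge_ereal_sup => _ [t At <-].
  by rewrite lee_fin hn.
have fS n e : (S n <= e%:E)%E -> S n \is a fin_num.
  by move=> Se; rewrite ge0_fin_numE// (le_lt_trans Se)// ltry.
apply/fine_cvgP; split; first by move: (hS 1 ltr01); apply: filterS => n /fS.
apply/cvgrPdist_le => e /hS; apply: filterS => n Sn.
rewrite sub0r normrN /= ger0_norm ?fine_ge0//; last exact: S0.
by rewrite -lee_fin fineK ?(fS _ _ Sn).
Qed.

Section skorokhod_distance.
Context {R : realType} {V : normedModType R}.
Implicit Types (f g h : skorokhod V) (l : R -> R) (e : R).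

Lemma J1_cvgP (f_ : nat -> skorokhod V) f : J1_cvg f_ f <-> exists l_ : nat -> R -> R,
  (forall n, time_change (l_ n)) /\
  forall e K, 0 < e -> \forall n \near \oo,
    (forall t, 0 <= t -> `|l_ n t - t| <= e) /\
    (forall t, 0 <= t <= K -> `|f_ n (l_ n t) - f t| <= e).
Proof.
split=> [[l_ [tl hl hf]]|[l_ [tl h]]]; exists l_.
  split => // e K e0.
  have K0 : 0 < Num.max 1 K by rewrite lt_max ltr01.
  have A1 : (`[0, +oo[%classic : set R) !=set0.
    by exists 0; rewrite /= in_itv/= lexx.
  have A2 : (`[0, Num.max 1 K]%classic : set R) !=set0.
    by exists 0; rewrite /= in_itv/= lexx ltW.
  have h1 := (cvg_ereal_sup0P A1 (fun n t => normr_ge0 (l_ n t - t))).1 hl.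
  have h2 := (cvg_ereal_sup0P A2
    (fun n t => normr_ge0 (f_ n (l_ n t) - f t))).1 (hf _ K0).
  move: (h1 _ e0) (h2 _ e0); apply: filterS2 => n {}h1 {}h2; split.
    by move=> t t0; apply: h1; rewrite /= in_itv/= t0.
  move=> t /andP[t0 tK]; apply: h2; rewrite /= in_itv/= t0 le_max tK orbT//.
split => //.
  apply/(cvg_ereal_sup0P (g := fun n t => `|l_ n t - t|)) => //.
    by exists 0; rewrite /= in_itv/= lexx.
  move=> e e0; move: (h e 1 e0); apply: filterS => n [+ _] t /=.
  by rewrite in_itv/= andbT; apply.
move=> K K0.
apply/(cvg_ereal_sup0P (g := fun n t => `|f_ n (l_ n t) - f t|)) => //.
  by exists 0; rewrite /= in_itv/= lexx ltW.
move=> e e0; move: (h e K e0); apply: filterS => n [_ +] t /=.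
by rewrite in_itv/=; apply.
Qed.

(* With the constraint at scale e imposed on [0, 1/e], the triangle inequality
   for [J1_dist] holds without any constant. *)
Definition J1_close e f g := exists l,
  [/\ time_change l, forall t, 0 <= t -> `|l t - t| <= e &
      forall t, 0 <= t -> t * e <= 1 -> `|f (l t) - g t| <= e].

(** Admitting the scale 1 unconditionally caps the distance, so that the triangle inequality has to
    be checked only for scales with sum at most 1. *)
Definition J1_dist f g : R := inf [set e | 0 < e /\ (J1_close e f g \/ e = 1)].

Lemma J1_close_le e e' f g : 0 < e -> e <= e' -> J1_close e f g ->
  J1_close e' f g.
Proof.
move=> e0 ee' [l [tl hl hf]]; exists l; split => // t t0.
  exact: le_trans (hl _ t0) _.
move=> te'; apply: (le_trans _ ee'); apply: hf => //.
by apply: (le_trans _ te'); rewrite ler_wpM2l.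
Qed.

(** Only the window needs care: f and g are compared at the time [l2 t], which may reach t + e2, so
    (t + e2) e1 <= 1 is required. After multiplication by e1 + e2 this splits into [a1], from the
    window of the sum, and [a2], from e1 + e2 <= 1. *)
Lemma J1_close_trans e1 e2 f g h : 0 < e1 -> 0 < e2 -> e1 + e2 <= 1 ->
  J1_close e1 f g -> J1_close e2 g h -> J1_close (e1 + e2) f h.
Proof.
move=> e10 e20 e121 [l1 [tl1 hl1 h1]] [l2 [tl2 hl2 h2]].
exists (l1 \o l2); split => /=; first exact: time_change_comp.
- move=> t t0; have l2t0 := time_change_ge0 tl2 t0.
  rewrite -(subrK (l2 t) (l1 _)) -addrA (le_trans (ler_normD _ _))//.
  by rewrite lerD// ?hl1// hl2.
- move=> t t0 te; have l2t0 := time_change_ge0 tl2 t0.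
  rewrite -(subrK (g (l2 t)) (f _)) -addrA (le_trans (ler_normD _ _))//.
  have te1 := mulr_ge0 t0 (ltW e10).
  apply: lerD; last by apply: h2 => //; lra.
  apply: h1 => //.
  have l2t : l2 t <= t + e2 by have := hl2 _ t0; rewrite ler_norml; lra.
  rewrite -(ler_pM2l (addr_gt0 e10 e20)) mulr1.
  have a1 : (e1 + e2) * (t * e1) <= e1.
    by rewrite mulrA; apply: ler_piMl; lra.
  have a2 : (e1 + e2) * e1 * e2 <= e2.
    by apply: ler_piMl; [lra|apply: mulr_ile1; lra].
  have a3 : (e1 + e2) * (l2 t * e1) <= (e1 + e2) * ((t + e2) * e1).
    by apply: ler_wpM2l; [lra|apply: ler_wpM2r; lra].
  lra.
Qed.

Let dset f g := [set e : R | 0 < e /\ (J1_close e f g \/ e = 1)].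

Let dset_inf f g : has_inf (dset f g).
Proof.
split; first by exists 1; split; [exact: ltr01|right].
by exists 0 => e [/ltW].
Qed.

Lemma J1_dist_ge0 f g : 0 <= J1_dist f g.
Proof. by apply: lb_le_inf => [|e [/ltW]//]; case: (dset_inf f g). Qed.

Lemma J1_dist_le e f g : 0 < e -> J1_close e f g -> J1_dist f g <= e.
Proof.
by move=> e0 efg; apply: ge_inf; [case: (dset_inf f g)|split => //; left].
Qed.

Lemma J1_dist_le1 f g : J1_dist f g <= 1.
Proof. by apply: ge_inf; [case: (dset_inf f g)|split => //; right]. Qed.

Lemma J1_dist_lt e f g : e <= 1 -> J1_dist f g < e -> J1_close e f g.
Proof.
have [ne _] := dset_inf f g; move=> e1 /(inf_lt ne) [e' [e'0 [efg|->]] e'e].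
  by apply: J1_close_le efg => //; exact: ltW.
by move: e'e; rewrite ltNge e1.
Qed.

Lemma J1_dist_xx f : J1_dist f f = 0.
Proof.
apply/eqP; rewrite eq_le J1_dist_ge0 andbT; apply/ler_addgt0Pl => e e0.
rewrite addr0; apply: J1_dist_le => //.
by exists id; split => [|t _|t _ _]; rewrite ?subrr ?normr0 ?ltW//; exact: time_change_id.
Qed.

Lemma J1_dist_triangle f g h : J1_dist f h <= J1_dist f g + J1_dist g h.
Proof.
have [d1|d1] := leP 1 (J1_dist f g + J1_dist g h).
  by apply: le_trans d1; exact: J1_dist_le1.
apply/ler_addgt0Pl => e e0.
(* The second bound keeps the sum of the two enlarged scales at most 1. *)
pose e' := Num.min (e / 2) ((1 - (J1_dist f g + J1_dist g h)) / 2).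
have [e'1 e'2] : e' <= e / 2 /\ e' <= (1 - (J1_dist f g + J1_dist g h)) / 2.
  by split; rewrite ge_min lexx ?orbT.
have e'0 : 0 < e' by rewrite lt_min; apply/andP; split; lra.
have d0 := J1_dist_ge0 f g; have d0' := J1_dist_ge0 g h.
apply: (@le_trans _ _ ((J1_dist f g + e') + (J1_dist g h + e'))); last lra.
apply: J1_dist_le; first lra.
by apply: J1_close_trans; try lra; apply: J1_dist_lt; lra.
Qed.

Lemma J1_dist_uniform e f g : 0 < e ->
  (forall t, 0 <= t -> t * e <= 1 -> `|f t - g t| <= e) -> J1_dist f g <= e.
Proof.
move=> e0 fg; apply: J1_dist_le => //; exists id; split => //.
  exact: time_change_id.
by move=> t _; rewrite subrr normr0 ltW.
Qed.

Lemma J1_cvg_dist (f_ : nat -> skorokhod V) f : J1_cvg f_ f -> J1_dist (f_ n) f @[n --> \oo] --> 0.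
Proof.
move=> /J1_cvgP [l [tl h]]; apply/cvgrPdist_le => e e0.
move: (h e e^-1 e0); apply: filterS => n [h1 h2].
rewrite sub0r normrN ger0_norm ?J1_dist_ge0//; apply: J1_dist_le => //.
exists (l n); split => // t t0 te; apply: h2.
by rewrite t0/= -div1r ler_pdivlMr.
Qed.

(** The time changes are inverted. An inverse may exceed t by e, hence the convergence is used on
    the window up to 1/e + e. *)
Lemma J1_cvg_dist_sym (f_ : nat -> skorokhod V) f :
  J1_cvg f_ f -> J1_dist f (f_ n) @[n --> \oo] --> 0.
Proof.
move=> /J1_cvgP [l [tl h]]; apply/cvgrPdist_le => e e0.
move: (h e (e^-1 + e) e0); apply: filterS => n [h1 h2].
rewrite sub0r normrN ger0_norm ?J1_dist_ge0//; apply: J1_dist_le => //.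
have [l' tl' ll'] := time_change_inv (tl n).
exists l'; have l'e t : 0 <= t -> `|l' t - t| <= e.
  move=> t0; have := h1 (l' t) (time_change_ge0 tl' t0).
  by rewrite ll'// distrC.
split => // t t0 te; have l't0 := time_change_ge0 tl' t0.
have := h2 (l' t); rewrite ll'// distrC; apply; rewrite l't0/=.
have te' : t <= e^-1 by rewrite -div1r ler_pdivlMr.
by have := l'e _ t0; rewrite ler_norml; lra.
Qed.

Lemma J1_dist_cvg (f_ : nat -> skorokhod V) f : J1_dist (f_ n) f @[n --> \oo] --> 0 -> J1_cvg f_ f.
Proof.
(* The added term puts the scale strictly above the infimum, so that a time change realising it
   exists. *)
move=> fd; pose e n := J1_dist (f_ n) f + n.+1%:R^-1.
have e0 n : 0 < e n by rewrite ltr_wpDl ?J1_dist_ge0// invr_gt0.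
have ecvg : e n @[n --> \oo] --> 0.
  rewrite -[X in _ --> X]addr0; apply: cvgD => //; exact: cvg_harmonic.
have : forall n, exists l, time_change l /\ (e n <= 1 ->
  (forall t, 0 <= t -> `|l t - t| <= e n) /\
  (forall t, 0 <= t -> t * e n <= 1 -> `|f_ n (l t) - f t| <= e n)).
  move=> n; have [e1|e1] := leP (e n) 1; last first.
    by exists id; split; [exact: time_change_id|].
  have [|l [tl h1 h2]] := @J1_dist_lt (e n) (f_ n) f e1.
    by rewrite ltrDl invr_gt0.
  by exists l; split.
move=> /choice [l hl]; apply/J1_cvgP; exists l; split; first by move=> n; case: (hl n).
move=> e1 K e10.
(* The three bounds make the scale usable, meet the tolerance e1 and extend the window over
   [0, K]. *)
pose e2 := Num.min 1 (Num.min e1 (Num.max 1 K)^-1).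
have K1 : 0 < Num.max 1 K by rewrite lt_max ltr01.
have e20 : 0 < e2 by rewrite !lt_min ltr01 e10 invr_gt0.
move/cvgrPdist_le : ecvg => /(_ _ e20); apply: filterS => n.
rewrite sub0r normrN ger0_norm ?(ltW (e0 n))// !le_min => /and3P[en1 ene1 enK].
have [_ /(_ en1) [h1 h2]] := hl n; split.
  by move=> t /h1 /le_trans; apply.
move=> t /andP[t0 tK]; apply: le_trans ene1; apply: h2 => //.
have tK' : t <= Num.max 1 K by rewrite le_max tK orbT.
apply: (@le_trans _ _ (Num.max 1 K * (Num.max 1 K)^-1)).
  by apply: ler_pM => //; exact: ltW.
by rewrite mulfV// gt_eqF.
Qed.

Lemma continuous_J1_cvg (T : topologicalType) (F : skorokhod V -> T)
    (f_ : nat -> skorokhod V) f :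
  continuous F -> J1_cvg f_ f -> F (f_ n) @[n --> \oo] --> F f.
Proof.
move=> cF ff A /cF [B [oB Bf BA]].
by have := oB _ _ ff Bf; apply: filterS => n /BA.
Qed.

(** The open sets are by definition the sequentially open ones, so sequential continuity is
    continuity. *)
Lemma J1_cvg_continuous (T : topologicalType) (F : skorokhod V -> T) :
  (forall (f_ : nat -> skorokhod V) f,
    J1_cvg f_ f -> F (f_ n) @[n --> \oo] --> F f) -> continuous F.
Proof.
move=> h; apply/continuousP => A oA.
change (J1_open (F @^-1` A)) => f_ f ff Af.
exact: h ff _ (open_nbhs_nbhs (conj oA Af)).
Qed.

End skorokhod_distance.

(** * Inf-convolutions and weak convergence *)

Section inf_convolution.
Context {R : realType} {V : normedModType R}.
Implicit Types (f g : skorokhod V).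
Variables (F : skorokhod V -> R) (M : R).
Hypothesis FM : forall f, `|F f| <= M.

Definition inf_convolution (k : R) (F : skorokhod V -> R) f : R :=
  inf [set F g + k * J1_dist g f | g in [set: skorokhod V]].

Let ic_lb k f : 0 <= k ->
  lbound [set F g + k * J1_dist g f | g in [set: skorokhod V]] (- M).
Proof.
move=> k0 _ [g _ <-]; have := FM g; rewrite ler_norml => /andP[FMg _].
by apply: (le_trans FMg); rewrite lerDl mulr_ge0// J1_dist_ge0.
Qed.

Lemma inf_convolution_le k f g : 0 <= k ->
  inf_convolution k F f <= F g + k * J1_dist g f.
Proof. by move=> k0; apply: ge_inf; [exists (- M); exact: ic_lb|exists g]. Qed.

Lemma inf_convolution_ge k f c : (forall g, c <= F g + k * J1_dist g f) ->
  c <= inf_convolution k F f.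
Proof.
move=> h; apply: lb_le_inf => [|_ [g _ <-]//].
by exists (F f + k * J1_dist f f); exists f.
Qed.

Lemma inf_convolution_leF k f : 0 <= k -> inf_convolution k F f <= F f.
Proof.
by move=> k0; have := inf_convolution_le f f k0; rewrite J1_dist_xx mulr0 addr0.
Qed.

Lemma inf_convolution_bound k f : 0 <= k -> `|inf_convolution k F f| <= M.
Proof.
move=> k0; rewrite ler_norml; apply/andP; split.
  by apply: inf_convolution_ge => g; apply: (@ic_lb k f k0); exists g.
apply: le_trans (inf_convolution_leF _ k0) _.
by have := FM f; rewrite ler_norml => /andP[].
Qed.

Lemma inf_convolution_lip k f g : 0 <= k ->
  inf_convolution k F f <= inf_convolution k F g + k * J1_dist g f.
Proof.
move=> k0; rewrite -lerBlDr; apply: inf_convolution_ge => h.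
rewrite lerBlDr; apply: le_trans (inf_convolution_le f h k0) _.
by rewrite -addrA lerD2l -mulrDr ler_wpM2l// J1_dist_triangle.
Qed.

Lemma inf_convolution_continuous k : 0 <= k -> continuous (inf_convolution k F).
Proof.
move=> k0; apply: J1_cvg_continuous => f_ f ff; apply/cvgrPdist_le => e e0.
have k1 : 0 < k + 1 by rewrite ltr_wpDl.
have e0' : 0 < e / (k + 1) by rewrite divr_gt0.
have /cvgrPdist_le /(_ _ e0') := J1_cvg_dist ff.
have /cvgrPdist_le /(_ _ e0') := J1_cvg_dist_sym ff.
apply: filterS2 => n.
rewrite !sub0r !(normrN (J1_dist _ _)) !(ger0_norm (J1_dist_ge0 _ _)) => d1 d2.
have ke : k * (e / (k + 1)) <= e.
  by rewrite mulrCA ger_pMr// ler_pdivrMr// mul1r lerDl.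
have kd g h : J1_dist g h <= e / (k + 1) -> k * J1_dist g h <= e.
  by move=> gh; apply: le_trans ke; rewrite ler_wpM2l.
have := inf_convolution_lip f (f_ n) k0; have := inf_convolution_lip (f_ n) f k0.
have := kd _ _ d1; have := kd _ _ d2.
by rewrite ler_norml; lra.
Qed.

(** As F is bounded, near-minimisers of the k-th infimum lie at distance O(1/k) from f. They
    converge to f in J1, so their values under F tend to F f and squeeze the infimum. *)
Lemma inf_convolution_cvg f : continuous F ->
  inf_convolution k%:R F f @[k --> \oo] --> F f.
Proof.
move=> cF; have M0 : 0 <= M by exact: le_trans (FM f).
have : forall k : nat, exists g, F g + k%:R * J1_dist g f <=
    inf_convolution k%:R F f + k.+1%:R^-1.
  move=> k; apply/not_existsP => h.
  suff : inf_convolution k%:R F f + k.+1%:R^-1 <= inf_convolution k%:R F f.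
    by apply/negP; rewrite -ltNge ltrDl invr_gt0.
  apply: inf_convolution_ge => g; apply/ltW; rewrite ltNge; apply/negP; exact: h.
move=> /choice [g hg].
have dg : J1_dist (g k) f @[k --> \oo] --> 0.
  (* Near-minimality gives k d <= 2 M + 1, and d <= 1 turns k into k + 1. *)
  apply: (@squeeze_cvgr _ _ _ _ (fun=> 0) (fun k => (2 * M + 2) * k.+1%:R^-1)).
  - near=> k; rewrite J1_dist_ge0 /= ler_pdivlMr//.
    have := hg k; have := inf_convolution_leF f (ler0n R k).
    have := FM f; have := FM (g k); rewrite !ler_norml.
    have : k.+1%:R^-1 <= 1 :> R by rewrite invf_le1// ler1n.
    have := J1_dist_le1 (g k) f; have := J1_dist_ge0 (g k) f.
    rewrite -natr1; lra.
  - exact: cvg_cst.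
  - rewrite -[X in _ --> X](mulr0 (2 * M + 2)); apply: cvgMl_tmp.
    exact: cvg_harmonic.
have Fg := continuous_J1_cvg cF (J1_dist_cvg dg).
apply/cvgrPdist_le => e e0; have e20 : 0 < e / 2 by rewrite divr_gt0.
move/cvgrPdist_le : Fg => /(_ _ e20); move/cvgrPdist_le : (@cvg_harmonic R) => /(_ _ e20).
apply: filterS2 => k /=; rewrite sub0r normrN gtr0_norm ?invr_gt0//.
move=> k1; have {k1} : (k.+1%:R^-1 : R) <= e / 2 by exact: k1.
have := hg k; have := inf_convolution_leF f (ler0n R k).
have := mulr_ge0 (ler0n R k) (J1_dist_ge0 (g k) f).
move: (k%:R * _) (k.+1%:R^-1) (inf_convolution _ _ _) (F (g k)) => a b c d' a0 cF' dac be.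
by rewrite !ler_norml => /andP[h1 h2]; apply/andP; split; lra.
Unshelve. all: by end_near. Qed.

End inf_convolution.

(** * Borel measurability through continuous real functions *)

Section borel_measurability.
Context {R : realType} {V : normedModType R}.

Lemma continuous_borel_measurable (F : skorokhod V -> R) :
  continuous F -> measurable_fun [set: borel (skorokhod V)] F.
Proof.
move=> /continuousP cF.
apply: (measurability _ (RGenOpens.measurableE R)).
move=> _ [_ [a [b ->] <-]]; rewrite setTI.
apply: sub_sigma_algebra; apply: cF; exact: interval_open.
Qed.

(* An open set U is {h > 0} for h the inf-convolution of the indicator of U. *)
Lemma measurable_fun_skorokhod d (T : measurableType d)
    (X : T -> borel (skorokhod V)) :
  (forall F : skorokhod V -> R, continuous F -> measurable_fun setT (F \o X)) ->
  measurable_fun setT X.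
Proof.
move=> h; apply: (@measurability _ _ T (borel (skorokhod V)) setT X
  (@open (skorokhod V)) erefl).
move=> _ [U oU <-]; rewrite setTI.
pose F (f : skorokhod V) : R := \1_U f.
have FM f : `|F f| <= 1 by rewrite /F indicE; case: (_ \in _); rewrite ?normr1 ?normr0.
have -> : X @^-1` U = (inf_convolution 1 F \o X) @^-1` `]0, +oo[.
  apply/seteqP; split=> w /=; rewrite in_itv/= andbT.
    move=> Uw; rewrite ltNge; apply/negP => ic0.
    (* The bound 1/(n + 2) is below 1, the cost of a point of U. The near-minimisers thus lie
       outside U while converging to [X w], against openness. *)
    have : forall n : nat, exists g, F g + 1 * J1_dist g (X w) <= n.+2%:R^-1.
      move=> n; apply/not_existsP => hg.
      suff : n.+2%:R^-1 <= inf_convolution 1 F (X w).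
        by apply/negP; rewrite -ltNge; apply: le_lt_trans ic0 _; rewrite invr_gt0.
      apply: inf_convolution_ge => g; apply/ltW; rewrite ltNge; apply/negP; exact: hg.
    move=> /choice [g hg].
    have gU n : ~ U (g n).
      move=> Ug; have := hg n; rewrite /F indicE mem_set// => /(le_trans _) h1.
      have : (1 : R) <= n.+2%:R^-1.
        by apply: h1; rewrite lerDl mul1r J1_dist_ge0.
      by apply/negP; rewrite -ltNge invf_lt1// ltr1n.
    have : J1_cvg g (X w).
      apply: J1_dist_cvg.
      apply: (@squeeze_cvgr _ _ _ _ (fun=> 0) (fun k => k.+1%:R^-1)).
      - near=> n; rewrite J1_dist_ge0 /=.
        apply: (@le_trans _ _ n.+2%:R^-1).
          apply: le_trans (hg n); rewrite mul1r lerDr /F indicE; exact: ler0n.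
        by rewrite lef_pV2 ?posrE// ler_nat.
      - exact: cvg_cst.
      - exact: cvg_harmonic.
    by move=> /oU/(_ Uw) [N _ /(_ N)]; move/(_ (leqnn _)); exact: gU.
  apply: contraPP => nU; apply/negP; rewrite -leNgt.
  apply: le_trans (inf_convolution_leF FM (X w) ler01) _.
  by rewrite /F indicE memNset.
rewrite -[X in measurable X]setTI; apply: h => //.
exact: (inf_convolution_continuous FM).
Unshelve. all: by end_near. Qed.

End borel_measurability.

(** * One-sided limits and local boundedness of paths *)

Section cadlag_paths.
Context {R : realType} {V : normedModType R}.
Implicit Types (f : skorokhod V) (t K : R).

Lemma path_right f t : f x @[x --> t^'+] --> f t.
Proof.
have [t0|t0] := ltP t 0; last exact: (path_cadlag f).1.
rewrite (path_neg f t0); apply: cvg_near_cst; near=> x.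
apply: path_neg; near: x; exact: nbhs_right_lt.
Unshelve. all: by end_near. Qed.

Lemma path_left f t : cvg (f x @[x --> t^'-]).
Proof.
have [t0|t0] := ltP 0 t; first exact: (path_cadlag f).2.
apply/cvg_ex; exists (f 0); apply: cvg_near_cst; near=> x.
apply: path_neg; apply: lt_le_trans t0; near: x; exact: nbhs_left_lt.
Unshelve. all: by end_near. Qed.

(** One-sided limits bound f near each point and compactness of the segment makes the bound uniform;
    negative arguments only repeat the value at 0. *)
Lemma path_bounded f K : exists2 M, 0 < M & forall t, t <= K -> `|f t| <= M.
Proof.
have : \forall M \near +oo%R, `[0, Num.max 0 K] `<=` [set t | `|f t| <= M].
  have /compact_near_coveringP := @segment_compact R 0 (Num.max 0 K).
  apply => t _.
  have /cvg_ex[l fl] := @path_left f t.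
  have /cvgrPdist_le/(_ 1 ltr01) := fl.
  have /cvgrPdist_le/(_ 1 ltr01) := path_right (f := f) (t := t).
  rewrite /at_right /at_left !near_withinE => hr hl.
  near_simpl; near=> x M => /=.
  have M1 : `|f t| + `|l| + 1 <= M by near: M; apply: nbhs_pinfty_ge; exact: num_real.
  have lg := normr_ge0 l; have fg := normr_ge0 (f t).
  have [xt|tx|->] := ltgtP x t; last lra.
  - have lx : `|l - f x| <= 1 by move: xt; near: x.
    have := ler_normB l (l - f x); rewrite opprB addrC subrK; lra.
  - have lx : `|f t - f x| <= 1 by move: tx; near: x.
    have := ler_normB (f t) (f t - f x); rewrite opprB addrC subrK; lra.
move=> [M0 [_ hM]]; exists (Num.max 1 (M0 + 1)); first by rewrite lt_max ltr01.
have M1 : M0 < Num.max 1 (M0 + 1) by rewrite lt_max ltrDl ltr01 orbT.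
have /= h := hM _ M1.
move=> t tK; have [t0|t0] := ltP t 0.
  by rewrite path_neg//; apply: h; rewrite /= in_itv/= lexx le_max lexx.
by apply: h; rewrite /= in_itv/= t0 le_max tK orbT.
Unshelve. all: by end_near. Qed.

End cadlag_paths.

(** * Bounded test functions and weak convergence *)

Section expectation_bounded.
Context d (Omega : measurableType d) (R : realType) (P : probability Omega R).

Lemma bounded_integrable (f : Omega -> R) (M : R) : measurable_fun setT f ->
  (forall w, `|f w| <= M) -> P.-integrable setT (EFin \o f).
Proof.
move=> mf fM; apply: measurable_bounded_integrable => //.
  by apply: (@le_lt_trans _ _ 1%E); [exact: probability_le1|rewrite ltry].
exists M; split; first exact: num_real.
by move=> x Mx w _ /=; apply: le_trans (fM w) _; exact: ltW.
Qed.

Lemma bounded_cvg_Rintegral (f_ : nat -> Omega -> R) (f : Omega -> R) (M : R) :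
  (forall n, measurable_fun setT (f_ n)) ->
  (forall n w, `|f_ n w| <= M) -> (forall w, f_ n w @[n --> \oo] --> f w) ->
  \int[P]_w f_ n w @[n --> \oo] --> \int[P]_w f w.
Proof.
move=> mf fM ff.
have mf0 : measurable_fun setT f by exact: (measurable_fun_cvg mf).
have f0M w : `|f w| <= M.
  apply: (@cvgr_to_le _ \oo _ _ (fun n => `|f_ n w|)); last by apply: nearW => n; exact: fM.
  by apply: cvg_norm; exact: ff.
apply: fine_cvg; rewrite fineK; last first.
  by apply: integrable_fin_num => //; exact: (bounded_integrable mf0 f0M).
apply: (@dominated_cvg _ _ _ P setT _ (fun n => EFin \o f_ n) (EFin \o f)
  (cst M%:E)) => //.
- by move=> n; exact/measurable_EFinP.
- move=> w _; apply/fine_cvgP; split; first by near=> n.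
  exact: ff.
- apply: (@bounded_integrable (cst M) M) => // w /=.
  by rewrite ger0_norm// (le_trans _ (f0M w)).
- by move=> n w _; rewrite /= lee_fin.
Unshelve. all: by end_near. Qed.

End expectation_bounded.

Section weak_convergence.
Context d (Omega : measurableType d) (R : realType) (P : probability Omega R)
  (V : normedModType R).
Implicit Types (X : {RV P >-> borel (skorokhod V)}) (F : skorokhod V -> R).

Lemma continuous_RV_measurable F X : continuous F -> measurable_fun setT (F \o X).
Proof. by move=> /continuous_borel_measurable cF; exact: measurableT_comp. Qed.

Lemma integral_distributionE F X (M : R) : continuous F -> (forall f, `|F f| <= M) ->
  (\int[distribution P X]_x (F x)%:E)%E = (\int[P]_w F (X w))%:E.
Proof.
move=> cF FM; have iF : P.-integrable setT (EFin \o (F \o X)).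
  apply: (bounded_integrable P (M := M) (continuous_RV_measurable X cF)) => w.
  exact: FM.
rewrite integral_distribution//.
  by rewrite fineK//; exact: integrable_fin_num.
by apply/measurable_EFinP; exact: continuous_borel_measurable cF.
Qed.

Lemma weak_cvgP (X_ : nat -> {RV P >-> borel (skorokhod V)}) X :
  weak_cvg (fun n => distribution P (X_ n)) (distribution P X) <->
  forall F (M : R), continuous F -> (forall f, `|F f| <= M) ->
    \int[P]_w F (X_ n w) @[n --> \oo] --> \int[P]_w F (X w).
Proof.
split=> [h F M cF FM|h F cF [M FM]].
  have /fine_cvg : (\int[P]_w F (X_ n w))%:E @[n --> \oo] --> (\int[P]_w F (X w))%:E.
    rewrite -(integral_distributionE X cF FM).
    under eq_fun do rewrite -(integral_distributionE _ cF FM).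
    by apply: h => //; exists M.
  by [].
rewrite (integral_distributionE X cF FM).
under eq_fun do rewrite (integral_distributionE _ cF FM).
by apply: cvg_EFin; [near=> n|exact: h].
Unshelve. all: by end_near. Qed.

Lemma Rintegral_indic (A : set Omega) : measurable A ->
  \int[P]_w (\1_A w : R) = fine (P A).
Proof. by move=> mA; rewrite /Rintegral integral_indic// setIT. Qed.

(** A lower bound for the integrals of F suffices, since it can be applied to -F as well. Off the
    bad event F_k(B_n) <= F_k(A_n) + k d(A_n, B_n) <= F(A_n) + k d(A_n, B_n); on it the loss is at
    most 2 M. The integral of F_k(B_n) tends to that of F_k(B), which is close to that of F(B) for
    large k. *)
Lemma weak_cvg_converging_together (A_ B_ : nat -> {RV P >-> borel (skorokhod V)}) B :
  weak_cvg (fun n => distribution P (B_ n)) (distribution P B) ->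
  (forall e, 0 < e -> \forall n \near \oo, exists bad : set Omega,
    [/\ measurable bad, fine (P bad) <= e &
        forall w, ~ bad w -> J1_dist (A_ n w) (B_ n w) <= e]) ->
  weak_cvg (fun n => distribution P (A_ n)) (distribution P B).
Proof.
move=> /weak_cvgP BB AB; apply/weak_cvgP.
have chain (e x1 x2 x3 x4 q : R) : `|x1 - x2| <= e / 4 -> `|x2 - x3| <= e / 4 ->
    x3 <= x4 + (e / 4 + q) -> q <= e / 4 -> x1 - e <= x4.
  by rewrite !ler_norml => /andP[_ ?] /andP[_ ?] ? ?; lra.
have half F (M : R) : continuous F -> (forall f, `|F f| <= M) -> forall e, 0 < e ->
    \forall n \near \oo, \int[P]_w F (B w) - e <= \int[P]_w F (A_ n w).
  move=> cF FM e e0.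
  have e40 : 0 < e / 4 by rewrite divr_gt0.
  have M0 : 0 <= M by exact: le_trans (FM point).
  have : \int[P]_w inf_convolution k%:R F (B w) @[k --> \oo] --> \int[P]_w F (B w).
    apply: (@bounded_cvg_Rintegral _ _ _ _ _ _ M).
    - move=> k; apply: (@continuous_RV_measurable (inf_convolution k%:R F)).
      exact: inf_convolution_continuous.
    - by move=> k w; exact: inf_convolution_bound.
    - by move=> w; exact: inf_convolution_cvg.
  move=> /cvgrPdist_le/(_ _ e40)[k _ /(_ k (leqnn _)) /= Fk].
  have cFk := inf_convolution_continuous FM (ler0n R k).
  have FkM f := inf_convolution_bound FM f (ler0n R k).
  have /cvgrPdist_le/(_ _ e40) BBk := BB _ _ cFk FkM.
  (* Two requirements: k times the distance, and 2 M times the probability of the bad event, are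
     each at most e/4. The added units avoid zero denominators. *)
  have e'0 : 0 < e / 4 / k.+1%:R by rewrite divr_gt0.
  have Me0 : 0 < e / (4 * (2 * M + 1)) by rewrite divr_gt0// mulr_gt0//; lra.
  have e''0 : 0 < Num.min (e / 4 / k.+1%:R) (e / (4 * (2 * M + 1))).
    by rewrite lt_min e'0.
  move: (AB _ e''0) BBk; apply: filterS2 => n [bad [mbad Pn hbad]] BBk.
  move: Pn; rewrite le_min => /andP[_ Pn].
  have iFk : P.-integrable setT (EFin \o (inf_convolution k%:R F \o B_ n)).
    exact: (bounded_integrable P (continuous_RV_measurable _ cFk) (fun w => FkM _)).
  have iF : P.-integrable setT (EFin \o (F \o A_ n)).
    exact: (bounded_integrable P (continuous_RV_measurable _ cF) (fun w => FM _)).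
  have i1 : P.-integrable setT (EFin \o (\1_bad : Omega -> R)).
    apply: (bounded_integrable P (M := 1)); first exact: measurable_indic.
    by move=> w; rewrite indicE; case: (_ \in _); rewrite ?normr1 ?normr0.
  have i1' : P.-integrable setT (EFin \o (fun w => 2 * M * \1_bad w : R)).
    exact: (integrableZl measurableT (2 * M) i1).
  have ic : P.-integrable setT (EFin \o (cst (e / 4) : Omega -> R)).
    apply: (bounded_integrable P (M := e / 4)) => // w; rewrite /= gtr0_norm//.
  have le1 : \int[P]_w inf_convolution k%:R F (B_ n w) <=
      \int[P]_w (F (A_ n w) + (e / 4 + 2 * M * \1_bad w)).
    apply: le_Rintegral => //.
      exact: (integrableD measurableT iF (integrableD measurableT ic i1')).
    move=> w _; have [wb|wb] := pselect (bad w).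
      rewrite indicE mem_set// mulr1.
      have /ler_normlW h1 := FkM (B_ n w).
      have : - M <= F (A_ n w) by have := FM (A_ n w); rewrite ler_norml => /andP[].
      rewrite -(lerD2r (2 * M)) mulr_natl mulr2n addKr => h2.
      by apply: (le_trans h1); apply: (le_trans h2); rewrite lerD2l lerDr ltW.
    rewrite indicE memNset// mulr0 addr0.
    apply: le_trans (inf_convolution_lip FM (B_ n w) (A_ n w) (ler0n R k)) _.
    apply: lerD; first exact: inf_convolution_leF.
    have := hbad _ wb; rewrite le_min => /andP[hb _].
    apply: le_trans (ler_wpM2l (ler0n R k) hb) _.
    by rewrite mulrCA ger_pMr// ler_pdivrMr// mul1r ler_nat.
  move: le1; rewrite RintegralD//; last exact: (integrableD measurableT ic i1').
  rewrite RintegralD// RintegralZl// Rintegral_cst// Rintegral_indic//.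
  rewrite [X in fine X](@probability_setT _ _ _ P) mulr1 => le1.
  have le2 : 2 * M * fine (P bad) <= e / 4.
    have M1 : 0 < 2 * M + 1 by rewrite ltr_wpDl// mulr_ge0.
    apply: (@le_trans _ _ (2 * M * (e / (4 * (2 * M + 1))))).
      by apply: ler_wpM2l => //; rewrite mulr_ge0.
    rewrite [4 * _]mulrC invfM !mulrA ler_pM2r ?invr_gt0//.
    by rewrite ler_pdivrMr// mulrC ler_wpM2l ?(ltW e0)// lerDl.
  exact: (chain _ _ _ _ _ _ Fk BBk le1 le2).
move=> F M cF FM; apply/cvgrPdist_le => e e0.
have h1 := half F M cF FM e e0.
have cNF : continuous (fun x => - F x) 
  by apply: J1_cvg_continuous => f_ f ff; apply: cvgN; exact: (continuous_J1_cvg cF ff).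
have NFM x : `|- F x| <= M by rewrite normrN.
have h2 := half _ M cNF NFM e e0.
move: h1 h2; apply: filterS2 => n h1.
have iN (C : nat -> {RV P >-> borel (skorokhod V)}) m :
    \int[P]_w (- F (C m w)) = - \int[P]_w F (C m w).
  under eq_Rintegral do rewrite -mulN1r.
  rewrite RintegralZl// ?mulN1r//.
  exact: (bounded_integrable P (continuous_RV_measurable (C m) cF) (fun w => FM _)).
rewrite (iN (fun=> B) 0%N) (iN A_) ler_norml => h2; apply/andP; split; lra.
Qed.

(* Dominate the indicator of {sup_[0,K] |f| > A} by a continuous function that
   vanishes as A grows. *)
Lemma weak_cvg_tight_sup (X_ : nat -> {RV P >-> borel (skorokhod V)}) X (K e : R) :
  weak_cvg (fun n => distribution P (X_ n)) (distribution P X) -> 0 < e ->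
  exists2 A, 0 < A & \forall n \near \oo, forall E : set Omega, measurable E ->
    (forall w, E w -> exists2 t, 0 <= t <= K & A < `|X_ n w t|) ->
    fine (P E) <= e.
Proof.
move=> /weak_cvgP XX e0.
have chain (x1 x2 q : R) : `|0 - x1| <= e / 2 -> `|x1 - x2| <= e / 2 -> q <= - x2 -> q <= e.
  by rewrite !ler_norml => /andP[? ?] /andP[? ?] ?; lra.
(* [K1] is both a window and a slope: closeness at scale 1/K1 compares paths on all of [0, K1],
   shifts times by at most 1, and a distance 1/K1 costs exactly the height 1 of the indicator. *)
pose K1 := Num.max 0 K + 1.
have K10 : 0 < K1 by rewrite ltr_wpDl// le_max lexx.
pose big (A : R) : set (skorokhod V) := [set f | exists2 t, 0 <= t <= K & A < `|f t|].
pose F (k : nat) f : R := - \1_(big k.+1%:R) f.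
have FM k f : `|F k f| <= 1.
  by rewrite /F indicE; case: (_ \in _); rewrite normrN ?normr1 ?normr0.
pose G k := inf_convolution K1 (F k).
have GM k f : `|G k f| <= 1 by exact: (inf_convolution_bound (FM k) _ (ltW K10)).
have cG k : continuous (G k) by exact: (inf_convolution_continuous (FM k) (ltW K10)).
(* If M bounds f on [0, K1] and k + 1 > M + 1, a path exceeding k + 1 on [0, K] is at distance at
   least 1/K1 from f, so the infimum defining [G k f] is 0. *)
have G0 f : G k f @[k --> \oo] --> 0.
  have [M M0 fM] := path_bounded f K1.
  apply: cvg_near_cst; exists (Num.truncn M).+1 => // k /= kM.
  have Mk : M + 1 < k.+1%:R.
    by rewrite -natr1 ltrD2r (lt_le_trans (truncnS_gt M))// ler_nat.
  apply/eqP; rewrite eq_le; apply/andP; split.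
    apply: le_trans (inf_convolution_leF (FM k) _ (ltW K10)) _.
    by rewrite /F indicE oppr_le0; exact: ler0n.
  apply: inf_convolution_ge => g; rewrite /F indicE.
  have [gb|_] := boolP (g \in _); last first.
    by rewrite oppr0 add0r mulr_ge0 ?J1_dist_ge0// ltW.
  rewrite -[X in 0 <= - X + _](mulfV (lt0r_neq0 K10)) addrC -mulrBr.
  apply: mulr_ge0; first exact: ltW.
  rewrite subr_ge0 leNgt; apply/negP => /J1_dist_lt.
  have K1V : K1^-1 <= 1 by rewrite invf_le1// lerDr le_max lexx.
  move=> /(_ K1V)[l [tl hl hf]].
  move: gb; rewrite inE => -[s /andP[s0]].
  have [t t0 <-] := time_change_surj tl s0 => ltK lt.
  have tK : t <= K1.
    have := hl _ t0; rewrite ler_norml => /andP[h _].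
    have : l t <= Num.max 0 K by rewrite le_max ltK orbT.
    by move: h; rewrite /K1; lra.
  have := hf t t0; rewrite -[X in _ <= X](mulfV (lt0r_neq0 K10)) ler_pM2r ?invr_gt0//.
  move=> /(_ tK) h; have := fM _ tK.
  have := ler_normD (g (l t) - f t) (f t); rewrite subrK; lra.
have : \int[P]_w G k (X w) @[k --> \oo] --> \int[P]_w (0 : R).
  apply: (@bounded_cvg_Rintegral _ _ _ _ _ _ 1) => // k.
  exact: (continuous_RV_measurable X (cG k)).
have e20 : 0 < e / 2 by rewrite divr_gt0.
rewrite Rintegral_cst// mul0r => /cvgrPdist_le/(_ _ e20)[k _ /(_ k (leqnn _)) /= Gk].
exists k.+1%:R => //.
have /cvgrPdist_le/(_ _ e20) := XX _ _ (cG k) (GM k).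
apply: filterS => n Gn E mE hE.
have iG : P.-integrable setT (EFin \o (G k \o X_ n)).
  exact: (bounded_integrable P (continuous_RV_measurable _ (cG k)) (fun w => GM k _)).
have iE : P.-integrable setT (EFin \o (\1_E : Omega -> R)).
  apply: (bounded_integrable P (M := 1)); first exact: measurable_indic.
  by move=> w; rewrite indicE; case: (_ \in _); rewrite ?normr1 ?normr0.
have : \int[P]_w \1_E w <= \int[P]_w (-1 * G k (X_ n w)).
  apply: le_Rintegral => //.
    exact: (integrableZl measurableT (-1) iG).
  move=> w _; rewrite mulN1r lerNr.
  apply: le_trans (inf_convolution_leF (FM k) _ (ltW K10)) _.
  rewrite /F lerN2 !indicE; have [wE|//] := boolP (w \in E).
  by rewrite mem_set//; apply: hE; rewrite inE in wE.
rewrite Rintegral_indic// RintegralZl// mulN1r.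
move=> h; exact: (chain _ _ _ Gk Gn h).
Qed.

End weak_convergence.

(** * The exponential convolution of a cadlag path *)

Section cadlag_regularity.
Context {R : realType}.
Implicit Types (f : skorokhod R) (t K : R).

(* To each point of D choose a rational number in the gap on its right. *)
Lemma right_isolated_countable (D : set R) :
  (forall s, D s -> exists2 e, 0 < e & forall u, s < u < s + e -> ~ D u) ->
  countable D.
Proof.
move=> iso.
have : forall s, exists q : rat, D s -> s < ratr q /\
    forall u, s < u -> u <= ratr q -> ~ D u.
  move=> s; have [Ds|nDs] := pselect (D s); last by exists 0.
  have [e e0 he] := iso s Ds.
  have [|q] := @rat_in_itvoo _ s (s + e); first by rewrite ltrDl.
  rewrite in_itv/= => /andP[sq qe]; exists q => _; split=> // u su uq.
  by apply: he; rewrite su (le_lt_trans uq).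
move=> /choice[q hq]; apply/countable_injP; exists (choice.pickle \o q).
move=> s t; rewrite !inE => Ds Dt /= /(pcan_inj choice.pickleK) qst.
have [sq hs] := hq s Ds; have [tq ht] := hq t Dt.
have [st|ts|//] := ltgtP s t.
  by exfalso; apply: (hs t st) => //; rewrite qst ltW.
by exfalso; apply: (ht s ts) => //; rewrite -qst ltW.
Qed.

(** By right continuity, a discontinuity is a failure of left continuity by more than some 1/(j +
    1). Right continuity at s also makes the oscillation small just after s, so points of [D j] are
    isolated on their right. *)
Lemma discontinuity_countable f : countable [set t | ~ {for t, continuous f}].
Proof.
pose D (j : nat) := [set t | ~ \forall u \near t^'-, `|f t - f u| <= j.+1%:R^-1].
apply: (@sub_countable _ _ _ (\bigcup_j D j)).
  apply: subset_card_le => t /= nt; apply: contrapT => nD; apply: nt.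
  apply/left_right_continuousP; split; last exact: path_right.
  apply/cvgrPdist_le => e e0.
  have /cvgrPdist_le/(_ _ e0)[j _ /(_ j (leqnn _)) /=] := @cvg_harmonic R.
  rewrite sub0r normrN ger0_norm ?invr_ge0// => je.
  have : \forall u \near t^'-, `|f t - f u| <= j.+1%:R^-1.
    by apply: contrapT => h; apply: nD; exists j.
  by apply: filterS => u; move/le_trans; apply.
apply: bigcup_countable => // j _; apply: right_isolated_countable => s _.
have j0 : 0 < j.+1%:R^-1 / 2 :> R by rewrite divr_gt0.
have /cvgrPdist_le/(_ _ j0) := @path_right _ _ f s.
rewrite /at_right near_withinE => -[e /= e0 he]; exists e => // u /andP[su ue].
apply; near=> v.
have he' x : s < x -> x < s + e -> `|f s - f x| <= j.+1%:R^-1 / 2.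
  move=> sx xe; apply: he => //=; rewrite ltr_norml; apply/andP; split; lra.
have vu : v < u by near: v; exact: nbhs_left_lt.
have sv : s < v by near: v; exact: nbhs_left_gt.
have := he' u su ue; have := he' v sv (lt_trans vu ue).
move: (j.+1%:R^-1) => c; rewrite !ler_norml => /andP[? ?] /andP[? ?].
apply/andP; split; lra.
Unshelve. all: by end_near. Qed.

(** The preimage of an open interval differs from its interior only by discontinuity points, a
    countable set. *)
Lemma path_measurable f : measurable_fun setT f.
Proof.
apply: (measurability _ (RGenOpens.measurableE R)).
move=> _ [_ [a [b ->] <-]]; rewrite setTI.
set U := `]a, b[%classic; set N := [set t | ~ {for t, continuous f}].
have -> : f @^-1` U = interior (f @^-1` U) `|` (f @^-1` U `&` N).
  apply/seteqP; split=> [t Ut|t [/interior_subset//|[]//]].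
  have [ct|nct] := pselect {for t, continuous f}; last by right.
  by left; apply: ct; apply: open_nbhs_nbhs; split => //; exact: interval_open.
apply: measurableU; first by apply: open_measurable; exact: open_interior.
apply: countable_measurable; first by move=> t; exact: measurable_set1.
apply: sub_countable (discontinuity_countable f).
by apply: subset_card_le => t [].
Qed.

(** With t = l_n u, the value f_n t is close to f u, and u is close to t, where f is continuous. *)
Lemma J1_cvg_pointwise (f_ : nat -> skorokhod R) f t : J1_cvg f_ f -> 0 <= t ->
  {for t, continuous f} -> f_ n t @[n --> \oo] --> f t.
Proof.
move=> /J1_cvgP[l [tl h]] t0 ct; apply/cvgrPdist_le => e e0.
have e20 : 0 < e / 2 by rewrite divr_gt0.
move/cvgrPdist_le : ct => /(_ _ e20)[a /= a0 ha].
have b0 : 0 < Num.min 1 (Num.min (a / 2) (e / 2)).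
  by rewrite !lt_min ltr01 e20 divr_gt0.
move: (h _ (t + 1) b0); apply: filterS => n [h1 h2].
have [u u0 lu] := time_change_surj (tl n) t0.
have := h1 _ u0; rewrite lu !le_min => /and3P[tu1 tua _].
have uK : u <= t + 1 by move: tu1; rewrite ler_norml; lra.
have := h2 u; rewrite u0 uK lu !le_min => /(_ isT) /and3P[_ _ fu].
have fa : `|f t - f u| <= e / 2.
  by apply: ha => /=; rewrite (le_lt_trans tua)//; lra.
move: fu fa; rewrite !ler_norml => /andP[? ?] /andP[? ?].
apply/andP; split; lra.
Qed.

Lemma J1_cvg_bounded (f_ : nat -> skorokhod R) f K : J1_cvg f_ f ->
  exists2 M, 0 < M & \forall n \near \oo, forall t, t <= K -> `|f_ n t| <= M.
Proof.
move=> /J1_cvgP[l [tl h]].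
have [M M0 fM] := path_bounded f (Num.max 0 K + 1).
exists (M + 1); first by rewrite addr_gt0.
move: (h 1 (Num.max 0 K + 1) ltr01); apply: filterS => n [h1 h2].
have hn t : 0 <= t -> t <= Num.max 0 K -> `|f_ n t| <= M + 1.
  move=> t0 tK; have [u u0 lu] := time_change_surj (tl n) t0.
  have uK : u <= Num.max 0 K + 1.
    by have := h1 _ u0; rewrite lu ler_norml; lra.
  have := h2 u; rewrite u0 uK lu => /(_ isT).
  by have := fM _ uK; have := ler_normD (f_ n t - f u) (f u); rewrite subrK; lra.
move=> t tK; have [t0|t0] := ltP t 0; last by apply: hn => //; rewrite le_max tK orbT.
by rewrite path_neg//; apply: hn => //; rewrite le_max lexx.
Qed.

Lemma path_integrable (f : R -> R) (D : set R) (M : R) : measurable D ->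
  (lebesgue_measure D < +oo)%E -> measurable_fun setT f ->
  (forall t, D t -> `|f t| <= M) ->
  (@lebesgue_measure R).-integrable D (EFin \o f).
Proof.
move=> mD Doo mf fM; apply: measurable_bounded_integrable => //.
  exact: measurable_funTS.
exists M; split; first exact: num_real.
by move=> x Mx t Dt /=; apply: le_trans (fM t Dt) _; exact: ltW.
Qed.

Lemma itv_measure_fin (i : interval R) (a b : R) : [set` i] `<=` `[a, b]%classic ->
  (lebesgue_measure [set` i] < +oo)%E.
Proof.
move=> iab; apply: (@le_lt_trans _ _ (lebesgue_measure `[a, b]%classic)).
  by apply: le_measure => //; rewrite inE; exact: measurable_itv.
by rewrite lebesgue_measure_itv /= -EFinB; case: ifP; rewrite ltry.
Qed.

(** Convergence holds off the countable, hence null, set of discontinuities of f. The dominating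
    constant is valid only from N on, whence the shift of the sequence. *)
Lemma J1_cvg_L1 (f_ : nat -> skorokhod R) f K : J1_cvg f_ f ->
  \int[lebesgue_measure]_(s in `[0, K]) `|f_ n s - f s| @[n --> \oo] --> 0.
Proof.
move=> ff; have [M M0 [N _ fM]] := J1_cvg_bounded K ff.
have [M' M'0 f'M] := path_bounded f K.
rewrite -(@cvg_shiftn N); apply: fine_cvg.
have mB (g : skorokhod R) : measurable_fun setT (fun s => `|g s - f s|).
  by apply: measurableT_comp => //; apply: measurable_funB; exact: path_measurable.
rewrite -[X in _ --> X](integral0 (@lebesgue_measure R) `[0, K]%classic).
have [] := @dominated_convergence _ _ _ (@lebesgue_measure R) `[0, K]%classic
  (measurable_itv _) (fun n s => (`|f_ (n + N)%N s - f s|)%:E) (cst 0%E)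
  (cst (M + M')%:E).
- by move=> n; apply: measurable_funTS; apply/measurable_EFinP; exact: mB.
- by [].
- exists [set t | ~ {for t, continuous f}]; split.
  + apply: countable_measurable; first by move=> t; exact: measurable_set1.
    exact: discontinuity_countable.
  + exact/countable_lebesgue_measure0/discontinuity_countable.
  + move=> t /= nt ct; apply: nt; rewrite in_itv/= => /andP[t0 tK].
    apply/fine_cvgP; split; first by near=> n.
    rewrite /comp /= (cvg_shiftn N (fun n => `|f_ n t - f t|)).
    suff : `|f_ n t - f t| @[n --> \oo] --> `|f t - f t| by rewrite subrr normr0.
    apply: cvg_norm; apply: cvgB; last exact: cvg_cst.
    exact: J1_cvg_pointwise.
- apply: (@path_integrable (cst (M + M')) _ (M + M')); first exact: measurable_itv.
  + exact: (@itv_measure_fin _ 0 K).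
  + by [].
  + by move=> t _ /=; rewrite ger0_norm// addr_ge0// ltW.
- apply: aeW => t n; rewrite /= in_itv/= => /andP[_ tK]; rewrite lee_fin normr_id.
  apply: le_trans (ler_normB _ _) _; apply: lerD; last exact: f'M.
  by apply: fM => //=; rewrite leq_addl.
- by move=> _ _; exact.
Unshelve. all: by end_near. Qed.

End cadlag_regularity.

Lemma expR_sub1_le (R : realType) (x : R) : `|expR x - 1| <= `|x| * expR `|x|.
Proof.
have e0 := expR_gt0 x; have e1 := expR_ge1Dx (- x).
have [x0|x0] := leP 0 x.
  rewrite !ger0_norm//; last by rewrite subr_ge0 -expR0 ler_expR.
  have : expR x * (1 - x) <= 1.
    by rewrite -[leRHS]expR0 -(subrr x) expRD ler_pM2l.
  lra.
rewrite !ltr0_norm//; last by rewrite subr_lt0 -expR0 ltr_expR.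
have := expR_ge1Dx x; have : 1 <= expR (- x) by rewrite -expR0 ler_expR; lra.
move: (expR x) (expR (- x)) => a b b1 a1; have : 0 <= - x * (b - 1) by apply: mulr_ge0; lra.
lra.
Qed.

Section exponential_convolution.
Context {R : realType} (gamma : R).
Implicit Types (f : skorokhod R) (s t u K : R).
Notation mu := (@lebesgue_measure R).

Definition exp_conv (f : R -> R) t : R :=
  \int[mu]_(s in `[0, t]) (expR (gamma * (t - s)) * f s).

Lemma expR_le_norm K u : `|u| <= K -> expR (gamma * u) <= expR (`|gamma| * K).
Proof.
move=> uK; rewrite ler_expR (le_trans (ler_norm _))// normrM ler_wpM2l//.
Qed.

Lemma expR_kernel_measurable f t :
  measurable_fun setT (fun s => expR (gamma * (t - s)) * f s).
Proof.
apply: measurable_funM; last exact: path_measurable.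
apply: (@measurableT_comp _ _ _ _ _ _ expR) => //.
by apply: measurable_funM => //; exact: measurable_funB.
Qed.

Lemma expR_kernel_bound f t K A u : 0 <= u <= K -> 0 <= t <= K ->
  (forall s, 0 <= s <= K -> `|f s| <= A) ->
  `|expR (gamma * (t - u)) * f u| <= expR (`|gamma| * K) * A.
Proof.
move=> uK tK fA; rewrite normrM (ger0_norm (expR_ge0 _)).
apply: ler_pM => //; last exact: fA.
by apply: expR_le_norm; rewrite ler_norml; apply/andP; split; lra.
Qed.

Lemma expR_kernel_integrable f t (i : interval R) K : 0 <= t <= K ->
  [set` i] `<=` `[0, K]%classic ->
  mu.-integrable [set` i] (EFin \o (fun s => expR (gamma * (t - s)) * f s)).
Proof.
move=> tK iK; have [A A0 fA] := path_bounded f K.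
apply: (@path_integrable _ _ _ (expR (`|gamma| * K) * A)).
- exact: measurable_itv.
- exact: (itv_measure_fin iK).
- exact: expR_kernel_measurable.
- move=> u /iK; rewrite /= in_itv/= => uK.
  by apply: expR_kernel_bound => // s /andP[_]; exact: fA.
Qed.

(** Variation of constants restarted at time s: what was accumulated before s grows exponentially,
    and only the input after s is integrated anew. *)
Lemma exp_conv_split f s t : 0 <= s <= t -> exp_conv f t =
  expR (gamma * (t - s)) * exp_conv f s +
  \int[mu]_(u in `]s, t]) (expR (gamma * (t - u)) * f u).
Proof.
move=> /andP[s0 st]; have t0 := le_trans s0 st.
have it := @expR_kernel_integrable f t `[0, t] t.
have is' := @expR_kernel_integrable f s `[0, s] s.
rewrite /exp_conv -RintegralZl//; last first.
  by apply: is' => //; rewrite s0 lexx.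
have -> : \int[mu]_(x in `[0, s])
    (expR (gamma * (t - s)) * (expR (gamma * (s - x)) * f x)) =
    \int[mu]_(x in `[0, s]) (expR (gamma * (t - x)) * f x).
  by apply: eq_Rintegral => x _; rewrite mulrA -expRD -mulrDr addrA subrK.
rewrite addrC -(@Rintegral_itvB _ _ (BLeft 0) (BRight t) s) ?subrK//.
by apply: it => //; rewrite t0 lexx.
Qed.

Lemma exp_conv_itv_le f K A s t : 0 <= s -> s <= t -> t <= K ->
  (forall u, 0 <= u <= K -> `|f u| <= A) ->
  `|\int[mu]_(u in `]s, t]) (expR (gamma * (t - u)) * f u)| <=
  expR (`|gamma| * K) * A * (t - s).
Proof.
move=> s0 st tK fA.
have sub : [set` `]s, t]] `<=` `[0, K]%classic.
  by move=> u /=; rewrite !in_itv/= => /andP[su ut]; apply/andP; split; lra.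
have t0K : 0 <= t <= K by rewrite (le_trans s0 st).
have ik := expR_kernel_integrable f t0K sub.
apply: le_trans (le_normr_Rintegral _ ik) _; first exact: measurable_itv.
apply: (@le_trans _ _ (\int[mu]_(u in `]s, t]) (cst (expR (`|gamma| * K) * A) u))).
  apply: le_Rintegral; first exact: measurable_itv.
  - exact: (integrable_norm ik).
  - apply: (@path_integrable _ _ _ `|expR (`|gamma| * K) * A|) => //.
    exact: (itv_measure_fin sub).
  - move=> u /sub; rewrite /= in_itv/= => uK; exact: expR_kernel_bound.
have mst : measurable (`]s, t]%classic : set R) by exact: measurable_itv.
rewrite (Rintegral_cst mu mst).
rewrite /= lebesgue_measure_itv/= lte_fin; case: ltP => [_|ts].
  by rewrite -EFinB.
by rewrite (_ : t = s) ?subrr//; apply/eqP; rewrite eq_le st ts.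
Qed.

Lemma exp_conv_le0 f t : t <= 0 -> exp_conv f t = 0.
Proof.
rewrite le_eqVlt => /predU1P[->|t0].
  by rewrite /exp_conv set_itv1 Rintegral_set1.
rewrite /exp_conv set_itv_ge ?Rintegral_set0//.
by rewrite bnd_simp -ltNge.
Qed.

Lemma exp_conv_bound f K A t : 0 <= t <= K ->
  (forall u, 0 <= u <= K -> `|f u| <= A) ->
  `|exp_conv f t| <= expR (`|gamma| * K) * A * K.
Proof.
move=> /andP[t0 tK] fA; rewrite (@exp_conv_split f 0 t) ?lexx//.
rewrite (@exp_conv_le0 f 0)// mulr0 add0r.
apply: le_trans (exp_conv_itv_le _ _ tK fA) _ => //.
rewrite subr0 ler_wpM2l// mulr_ge0 ?expR_ge0//.
by apply: le_trans (fA 0 _) => //; rewrite lexx (le_trans t0 tK).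
Qed.

(** With E = e^(|gamma| K), the growth of the part accumulated before s contributes |gamma| (t - s)
    E times E A K, and the new input E A (t - s), weakened to E^2 A (t - s) for a common factor. *)
Lemma exp_conv_lip f K A s t : 0 <= s -> s <= t -> t <= K ->
  (forall u, 0 <= u <= K -> `|f u| <= A) ->
  `|exp_conv f t - exp_conv f s| <=
  expR (`|gamma| * K) ^+ 2 * (1 + `|gamma| * K) * A * (t - s).
Proof.
move=> s0 st tK fA; rewrite (@exp_conv_split f s t) ?s0//.
set E := expR (`|gamma| * K).
have K0 : 0 <= K by lra.
have A0 : 0 <= A by apply: le_trans (fA 0 _) => //; rewrite lexx.
have E1 : 1 <= E by rewrite /E -expR0 ler_expR mulr_ge0.
have h1 := exp_conv_itv_le s0 st tK fA; rewrite -/E in h1.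
have s0K : 0 <= s <= K by apply/andP; split; lra.
have h2 := exp_conv_bound s0K fA; rewrite -/E in h2.
have h3 : `|expR (gamma * (t - s)) - 1| <= `|gamma| * (t - s) * E.
  apply: le_trans (expR_sub1_le _) _; rewrite normrM.
  rewrite (ger0_norm (_ : 0 <= t - s)); last by lra.
  apply: ler_wpM2l; first by rewrite mulr_ge0// subr_ge0.
  by rewrite ler_expR ler_wpM2l//; lra.
have -> : expR (gamma * (t - s)) * exp_conv f s +
  \int[mu]_(u in `]s, t]) (expR (gamma * (t - u)) * f u) - exp_conv f s =
  (expR (gamma * (t - s)) - 1) * exp_conv f s +
  \int[mu]_(u in `]s, t]) (expR (gamma * (t - u)) * f u) by ring.
apply: le_trans (ler_normD _ _) _; rewrite normrM.
have h4 : `|expR (gamma * (t - s)) - 1| * `|exp_conv f s| <=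
    (`|gamma| * (t - s) * E) * (E * A * K) by apply: ler_pM.
have h5 : E * A * (t - s) <= E ^+ 2 * A * (t - s).
  apply: ler_wpM2r; first by lra.
  by apply: ler_wpM2r => //; rewrite expr2; apply: ler_peMl => //; lra.
apply: le_trans (lerD h4 (le_trans h1 h5)) _.
by rewrite le_eqVlt; apply/orP; left; apply/eqP; ring.
Qed.

Lemma exp_conv_continuous f : continuous (exp_conv f).
Proof.
move=> t; apply/cvgrPdist_le => e e0.
pose K := Num.max 0 t + 1.
have [A A0 fA] := path_bounded f K.
have fA' u : 0 <= u <= K -> `|f u| <= A by move=> /andP[_]; exact: fA.
pose C := expR (`|gamma| * K) ^+ 2 * (1 + `|gamma| * K) * A.
have K0 : 0 <= K by rewrite addr_ge0// le_max lexx.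
have C0 : 0 < C.
  by rewrite !mulr_gt0// ?exprn_gt0 ?expR_gt0// ltr_pwDl// mulr_ge0.
(* The convolution vanishes on ]-oo, 0], so the Lipschitz bound extends to negative times. *)
have lip s u : s <= u -> u <= K -> `|exp_conv f u - exp_conv f s| <= C * (u - s).
  move=> su uK; have [s0|s0] := leP 0 s; first exact: exp_conv_lip.
  rewrite (exp_conv_le0 f (ltW s0)) subr0.
  have [u0|u0] := leP u 0.
    by rewrite exp_conv_le0// normr0 mulr_ge0 ?subr_ge0//; exact: ltW.
  have := @exp_conv_lip f K A 0 u (lexx _) (ltW u0) uK fA'.
  rewrite (@exp_conv_le0 f 0)// subr0 -/C => /le_trans; apply.
  by rewrite ler_pM2l//; lra.
have m0 : 0 < Num.min 1 (e / C) by rewrite lt_min ltr01 divr_gt0.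
have /cvgrPdist_le/(_ _ m0) idt : (fun s : R => s) @ t --> t by exact: cvg_id.
near=> s.
have ts : `|t - s| <= Num.min 1 (e / C).
  by near: s; exact: idt.
have tK : t <= K - 1 by rewrite /K addrK le_max lexx orbT.
move: ts; rewrite le_min => /andP[ts1 tsC].
have {}tsC : C * `|t - s| <= e by rewrite mulrC -ler_pdivlMr.
apply: le_trans tsC.
have [st|ts] := leP s t.
  by rewrite (ger0_norm (_ : 0 <= t - s)) ?subr_ge0//; apply: lip => //; lra.
rewrite distrC (distrC t) (gtr0_norm (_ : 0 < s - t)) ?subr_gt0//.
apply: lip; first exact: ltW.
by move: ts1; rewrite ler_norml; lra.
Unshelve. all: by end_near. Qed.

End exponential_convolution.

(** * J1 continuity of the map f -> (f, conv f) *)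

Section colvec2_norm.
Context {R : realType}.
Implicit Types a b c d e : R.

Lemma colvec2_dist_le a b c d e : `|a - c| <= e -> `|b - d| <= e ->
  `|colvec2 a b - colvec2 c d| <= e.
Proof.
move=> ac bd; have e0 : 0 <= e by exact: le_trans ac.
rewrite /Num.norm /= mx_normrE; apply: bigmax_le => //= -[i j] _.
by rewrite !mxE /=; case: ifP.
Qed.

Lemma colvec2_cvg (T : Type) (F : set_system T) (FF : Filter F) (f g : T -> R) a b :
  f @ F --> a -> g @ F --> b -> (fun x => colvec2 (f x) (g x)) @ F --> colvec2 a b.
Proof.
move=> /cvgrPdist_le fa /cvgrPdist_le gb; apply/cvgrPdist_le => e e0.
move: (fa e e0) (gb e e0); apply: filterS2 => x; exact: colvec2_dist_le.
Qed.

End colvec2_norm.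

Section exp_conv_graph.
Context {R : realType} (gamma : R).
Implicit Types f : skorokhod R.

Let graph f t := colvec2 (f t) (exp_conv gamma f t).

Let graph_cadlag f : cadlag (graph f).
Proof.
split=> t t0.
  apply: colvec2_cvg; first exact: path_right.
  by apply: cvg_at_right_filter; exact: exp_conv_continuous.
have /cvg_ex[l fl] := @path_left _ _ f t.
apply/cvg_ex; exists (colvec2 l (exp_conv gamma f t)); apply: colvec2_cvg => //.
by apply: cvg_at_left_filter; exact: exp_conv_continuous.
Qed.

Let graph_neg f t : t < 0 -> graph f t = graph f 0.
Proof. by move=> t0; rewrite /graph path_neg// !exp_conv_le0// ltW. Qed.

Definition exp_conv_graph f : skorokhod 'cV[R]_2 :=
  Skorokhod (@graph_cadlag f) (@graph_neg f).

Lemma exp_conv_dist_le (f g : skorokhod R) t K : 0 <= t <= K ->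
  `|exp_conv gamma f t - exp_conv gamma g t| <= expR (`|gamma| * K) *
    \int[lebesgue_measure]_(s in `[0, K]) `|f s - g s|.
Proof.
move=> tK; have /andP[t0 tK'] := tK.
have mt := @measurable_itv R `[0, t].
have mK := @measurable_itv R `[0, K].
have sub : `[0, t]%classic `<=` `[0, K]%classic.
  by move=> u /=; rewrite !in_itv/= => /andP[-> /le_trans]; apply.
have i1 h := expR_kernel_integrable gamma h tK sub.
have ifg : (@lebesgue_measure R).-integrable `[0, K]%classic (EFin \o (fun s => `|f s - g s|)).
  have [A A0 fA] := path_bounded f K; have [B B0 gB] := path_bounded g K.
  apply: (@path_integrable _ _ _ (A + B)) => //.
  - exact: (@itv_measure_fin _ _ 0 K).
  - apply: measurableT_comp => //.
    by apply: measurable_funB; exact: path_measurable.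
  - move=> s; rewrite /= in_itv/= => /andP[_ sK].
    by rewrite normr_id (le_trans (ler_normB _ _))// lerD ?fA ?gB.
have ifgt : (@lebesgue_measure R).-integrable `[0, t]%classic (EFin \o (fun s => `|f s - g s|)).
  exact: integrableS ifg.
have idiff := @integrableB _ _ R (@lebesgue_measure R) _ (measurable_itv _) _ _ (i1 f) (i1 g).
rewrite /exp_conv -RintegralB//.
apply: le_trans (le_normr_Rintegral _ idiff) _; first exact: measurable_itv.
apply: (@le_trans _ _ (\int[lebesgue_measure]_(s in `[0, t])
    (expR (`|gamma| * K) * `|f s - g s|))).
  apply: le_Rintegral => //.
  - exact: (integrable_norm idiff).
  - exact: (@integrableZl _ _ R (@lebesgue_measure R) _ (measurable_itv _) _ _ ifgt).
  - move=> s; rewrite /= in_itv/= => /andP[s0 st].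
    rewrite -mulrBr normrM (ger0_norm (expR_ge0 _)) ler_wpM2r//.
    by apply: expR_le_norm; rewrite ler_norml; apply/andP; split; lra.
rewrite RintegralZl//; apply: ler_wpM2l; first exact: expR_ge0.
rewrite -lee_fin /Rintegral !fineK ?integrable_fin_num//.
apply: ge0_subset_integral => //; first exact: (measurable_int _ ifg).
Qed.

(** Convergence of pairs needs one time change for both coordinates, and those of f_n serve: L1
    convergence makes the convolutions uniformly close, and replacing [l n t] by t costs at most C
    |l_n t - t| since the limiting convolution is Lipschitz. *)
Lemma exp_conv_graph_J1_cvg (f_ : nat -> skorokhod R) f :
  J1_cvg f_ f -> J1_cvg (fun n => exp_conv_graph (f_ n)) (exp_conv_graph f).
Proof.
move=> ff; have /J1_cvgP[l [tl h]] := ff; apply/J1_cvgP; exists l; split => // e K e0.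
set K1 := Num.max 0 K + 1.
have K10 : 0 < K1 by rewrite ltr_wpDl// le_max lexx.
have [A A0 fA] := path_bounded f K1.
pose C := expR (`|gamma| * K1) ^+ 2 * (1 + `|gamma| * K1) * A.
have C0 : 0 < C.
  by rewrite !mulr_gt0// ?exprn_gt0 ?expR_gt0// ltr_pwDl// mulr_ge0// ltW.
pose a := Num.min (Num.min 1 e) (e / 2 / C).
have a0 : 0 < a by rewrite !lt_min ltr01 e0 !divr_gt0.
have E0 : 0 < e / 2 / expR (`|gamma| * K1) by rewrite !divr_gt0// expR_gt0.
have /cvgrPdist_le/(_ _ E0) := J1_cvg_L1 K1 ff.
move: (h a K1 a0); apply: filterS2 => n [h1 h2].
rewrite sub0r normrN ger0_norm ?Rintegral_ge0// => h3; split.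
  by move=> t /h1 /le_trans; apply; rewrite /a !ge_min lexx orbT.
move=> t /andP[t0 tK]; apply: colvec2_dist_le.
  have tK1 : 0 <= t <= K1.
    by rewrite t0 (le_trans tK)// /K1 ler_wpDr// le_max lexx orbT.
  by apply: (le_trans (h2 _ tK1)); rewrite /a !ge_min lexx orbT.
have lt0 := time_change_ge0 (tl n) t0.
have := h1 _ t0; rewrite {1}/a !le_min => /andP[/andP[lt1 _] ltC].
have KK : K <= Num.max 0 K by rewrite le_max lexx orbT.
have ltK : l n t <= K1 by move: lt1; rewrite ler_norml /K1; lra.
have tK1 : t <= K1 by rewrite /K1; lra.
rewrite -(subrK (exp_conv gamma f (l n t)) (exp_conv gamma (f_ n) _)) -addrA.
apply: le_trans (ler_normD _ _) _; rewrite (splitr e); apply: lerD.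
  apply: le_trans (exp_conv_dist_le _ _ (K := K1) _) _; first by rewrite lt0.
  by rewrite mulrC -ler_pdivlMr ?expR_gt0.
apply: (@le_trans _ _ (C * `|l n t - t|)); last first.
  by rewrite mulrC -ler_pdivlMr.
have fA' u : 0 <= u <= K1 -> `|f u| <= A by move=> /andP[_]; exact: fA.
have [tl'|tl'] := leP t (l n t).
  by rewrite (ger0_norm (_ : 0 <= l n t - t)) ?subr_ge0//; exact: exp_conv_lip.
rewrite distrC (distrC (l n t)) (gtr0_norm (_ : 0 < t - l n t)) ?subr_gt0//.
by apply: exp_conv_lip => //; exact: ltW.
Qed.

End exp_conv_graph.

(** * Step paths and their measurability *)

Section step_paths.
Context {R : realType} {V : normedModType R} (n : nat).
Implicit Types v : nat -> V.

Let step v t := v (Num.truncn (n%:R * t : R)).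

Let step_near_right (t : R) :
  \forall x \near t^'+, Num.truncn (n%:R * x) = Num.truncn (n%:R * t).
Proof.
have [->|n0] := eqVneq n 0%N; first by near=> x; rewrite !mul0r.
have n0' : 0 < n%:R :> R by rewrite ltr0n lt0n.
have h : t < (Num.truncn (n%:R * t)).+1%:R / n%:R.
  by rewrite ltr_pdivlMr// mulrC truncnS_gt.
near=> x.
have xt : t < x by near: x; exact: nbhs_right_gt.
have xh : x < (Num.truncn (n%:R * t)).+1%:R / n%:R by near: x; exact: nbhs_right_lt.
apply/eqP; rewrite eqn_leq; apply/andP; split; last first.
  by apply: le_truncn; rewrite ler_pM2l// ltW.
by rewrite truncn_le_nat mulrC -ltr_pdivlMr.
Unshelve. all: by end_near. Qed.

Let step_near_left (t : R) :
  exists k, \forall x \near t^'-, Num.truncn (n%:R * x) = k.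
Proof.
have [->|n0] := eqVneq n 0%N.
  by exists 0%N; near=> x; rewrite !mul0r truncn0.
have n0' : 0 < n%:R :> R by rewrite ltr0n lt0n.
set k := Num.truncn (n%:R * t).
have [kt|tk] := ltP (k%:R / n%:R) t.
  exists k; near=> x.
  have xt : x < t by near: x; exact: nbhs_left_lt.
  have kx : k%:R / n%:R < x by near: x; exact: nbhs_left_gt.
  apply/eqP; rewrite eqn_leq; apply/andP; split.
    by apply: le_truncn; rewrite ler_pM2l// ltW.
  case Ek : k kx => [//|j] jx; rewrite truncn_gt_nat mulrC -ler_pdivrMr//.
  exact: ltW.
(* Here t <= k/n: either t is the jump time k/n and the value on its left is k - 1, or k = 0, where
   truncation also gives 0 on the left. *)
exists k.-1.
case Ek : k => [|j] /=.
  near=> x; apply/eqP; rewrite -leqn0 -Ek; apply: le_truncn.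
  by rewrite ler_pM2l//; near: x; exact: nbhs_left_le.
have jt : j%:R / n%:R < t.
  have : (j < k)%N by rewrite Ek.
  rewrite truncn_gt_nat => jt; rewrite ltr_pdivrMr// mulrC.
  by apply: lt_le_trans jt; rewrite ltr_nat.
near=> x.
have xt : x < t by near: x; exact: nbhs_left_lt.
have jx : j%:R / n%:R < x by near: x; exact: nbhs_left_gt.
apply/eqP; rewrite eqn_leq; apply/andP; split.
  rewrite truncn_le_nat mulrC -ltr_pdivlMr//.
  by apply: lt_le_trans xt _; rewrite -Ek.
case: (j) jx => // i jx; rewrite truncn_gt_nat mulrC -ler_pdivrMr//.
exact: ltW.
Unshelve. all: by end_near. Qed.

Let step_cadlag v : cadlag (step v).
Proof.
split=> t _.
  apply: cvg_near_cst; move: (step_near_right t).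
  by apply: filterS => x; rewrite /step => ->.
have [k hk] := step_near_left t.
apply/cvg_ex; exists (v k); apply: cvg_near_cst; move: hk.
by apply: filterS => x; rewrite /step => ->.
Qed.

Let step_neg v t : t < 0 -> step v t = step v 0.
Proof.
move=> t0; rewrite /step mulr0 truncn0; congr v; apply/eqP; rewrite -leqn0.
rewrite -(@truncn0 R); apply: le_truncn; apply: mulr_ge0_le0 => //; exact: ltW.
Qed.

Definition step_path v : skorokhod V := Skorokhod (@step_cadlag v) (@step_neg v).

Lemma step_pathE v t : step_path v t = v (Num.truncn (n%:R * t)).
Proof. by []. Qed.

(* Stopping the steps at time k makes the path a function of finitely many
   discrete variables, and does not change it on bounded time intervals. *)
Lemma step_path_stopped_cvg v :
  J1_cvg (fun k => step_path (fun i => v (minn i k))) (step_path v).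
Proof.
apply/J1_cvgP; exists (fun=> id); split; first by move=> _; exact: time_change_id.
move=> e K e0; exists (Num.truncn (n%:R * K)) => // k /= Kk; split.
  by move=> t _; rewrite subrr normr0 ltW.
move=> t /andP[t0 tK]; rewrite /step/= (minn_idPl _) ?subrr ?normr0 ?ltW//.
by apply: leq_trans Kk; apply: le_truncn; rewrite ler_wpM2l.
Qed.

End step_paths.

(* The first k + 1 values of a discrete process form a countable-valued random
   variable, of which the stopped path is a function. *)
Lemma step_path_measurable (R : realType) (V : normedModType R) d
    (T : measurableType d) (C : countType) n
    (v : C -> V) (q : nat -> T -> C) :
  (forall k c, measurable (q k @^-1` [set c])) ->
  measurable_fun setT
    (fun w => step_path n (fun k => v (q k w)) : borel (skorokhod V)).
Proof.
move=> mq; apply: measurable_fun_skorokhod => F cF.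
apply: (@measurable_fun_cvg _ _ _ _ (fun k w =>
   F (step_path n (fun i => v (q (minn i k) w))))); last first.
  by move=> w _; exact: (continuous_J1_cvg cF (step_path_stopped_cvg n (fun i => v (q i w)))).
move=> k; pose Q w := [tuple q i w | i < k.+1].
pose G (s : k.+1.-tuple C) := F (step_path n (fun i => v (tnth s (inord (minn i k))))).
have -> : (fun w => F (step_path n (fun i => v (q (minn i k) w)))) = G \o Q.
  apply/funext => w; rewrite /G /Q /=; congr (F (step_path _ _)); apply/funext => i.
  by rewrite tnth_mktuple inordK// ltnS geq_minr.
move=> _ B mB; rewrite setTI.
have mQ s : measurable (Q @^-1` [set s]).
  have -> : Q @^-1` [set s] =
      \bigcap_(i in `I_k.+1) (q i @^-1` [set tnth s (inord i)]).
    apply/seteqP; split=> [w <- i /= ik|w Qw]; first by rewrite tnth_mktuple inordK.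
    apply: eq_from_tnth => i; rewrite tnth_mktuple.
    by have /= := Qw i (ltn_ord i); rewrite inord_val.
  by apply: bigcap_measurableType => i _; exact: mq.
have -> : (G \o Q) @^-1` B =
    \bigcup_s (if pselect (B (G s)) then Q @^-1` [set s] else set0).
  apply/seteqP; split=> [w Bw|w [s _]].
    by exists (Q w) => //; case: pselect.
  by case: pselect => // Bs Qs; rewrite /preimage/= Qs.
apply: countable_bigcupT_measurable => [|s]; first exact: countableP.
by case: pselect => ?; [exact: mQ|exact: measurable0].
Qed.

(** * Moments of random sums *)

Section measurable_countable_index.
Context d (T : measurableType d) d' (U : measurableType d').

Lemma measurable_fun_nat_index (V : T -> nat) (s : nat -> T -> U) :
  measurable_fun setT V -> (forall v, measurable_fun setT (s v)) ->
  measurable_fun setT (fun w => s (V w) w).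
Proof.
move=> mV ms _ B mB; rewrite setTI.
have -> : (fun w => s (V w) w) @^-1` B =
    \bigcup_v ((V @^-1` [set v]) `&` (s v @^-1` B)).
  by apply/seteqP; split=> [w Bw|w [v _ [<-]//]]; exists (V w).
apply: bigcupT_measurable => v; apply: measurableI.
  by rewrite -[X in measurable X]setTI; apply: mV.
by rewrite -[X in measurable X]setTI; apply: ms.
Qed.

Lemma measurable_fun_nat (h : nat -> U) (V : T -> nat) :
  measurable_fun setT V -> measurable_fun setT (h \o V).
Proof. by move=> mV; exact: (@measurable_fun_nat_index V (fun v _ => h v)). Qed.

End measurable_countable_index.

Lemma measurable_fun_nat2 d (T : measurableType d) d' (U : measurableType d')
    (h : nat -> nat -> U) (V W : T -> nat) :
  measurable_fun setT V -> measurable_fun setT W ->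
  measurable_fun setT (fun w => h (V w) (W w)).
Proof.
move=> mV mW; apply: (@measurable_fun_nat_index _ _ _ _ V (fun v w => h v (W w))) => // v.
exact: measurable_fun_nat.
Qed.

Lemma measurable_fun_sumn d (T : measurableType d) (f : nat -> T -> nat) m n :
  (forall i, (m <= i < n)%N -> measurable_fun setT (f i)) ->
  measurable_fun setT (fun w => (\sum_(m <= i < n) f i w)%N).
Proof.
elim: n => [|n IH] mf.
  by apply: (eq_measurable_fun (cst 0%N)) => // w _; rewrite big_geq.
have [mn|nm] := leqP m n; last first.
  by apply: (eq_measurable_fun (cst 0%N)) => // w _; rewrite big_geq.
apply: (eq_measurable_fun (fun w => (\sum_(m <= i < n) f i w + f n w)%N)).
  by move=> w _; rewrite big_nat_recr.
apply: measurable_fun_nat2; last by apply: mf; rewrite mn /=.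
by apply: IH => i /andP[mi i_n]; apply: mf; rewrite mi ltnW.
Qed.

(* If the pi-system G is independent of X, then, given <<s G>>, the variable X
   may be integrated out. *)
Section freezing.
Context d (T : measurableType d) (R : realType) (P : probability T R).
Variables (X : {RV P >-> nat}) (G : set (set T)).
Hypothesis Gmeas : G `<=` measurable.
Hypothesis GT : G setT.
Hypothesis GI : setI_closed G.
Hypothesis indepG : forall A B, G A -> P (A `&` X @^-1` B) = (P A * P (X @^-1` B))%E.

(** The same points with the smaller sigma-algebra: measurability on [TG] expresses dependence on
    the information in G alone. *)
Let TG := g_sigma_algebraType G.

Lemma sub_sigma_measurable (A : set T) : <<s G >> A -> measurable A.
Proof. by move=> sA; apply: sA; split => //; exact: sigma_algebra_measurable. Qed.

Let idG : T -> TG := id.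

Let midG : measurable_fun setT idG.
Proof. by move=> _ A mA; rewrite setTI; exact: sub_sigma_measurable. Qed.

(** Both sides are finite measures in A that agree on the pi-system G, which contains the whole
    space. *)
Lemma sub_sigma_independent (A : set T) (B : set nat) : <<s G >> A ->
  P (A `&` X @^-1` B) = (P A * P (X @^-1` B))%E.
Proof.
have mXB : measurable (X @^-1` B).
  by rewrite -[X in measurable X]setTI; exact: (measurable_funPT X).
have fB : P (X @^-1` B) \is a fin_num by exact: fin_num_measure.
move=> sA; have b0 : 0 <= fine (P (X @^-1` B)) by exact: fine_ge0.
have h (A' : set T) : mscale (NngNum b0) P A' = (P A' * P (X @^-1` B))%E.
  by rewrite /mscale /= fineK// muleC.
rewrite -h; apply: (@g_sigma_algebra_measure_unique _ R T G Gmeas (fun=> setT)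
  (fun=> GT) (bigcup_const setT (ex_intro _ 0%N I)) (mrestr P mXB)
  (mscale (NngNum b0) P) GI _ _ A sA).
  by move=> A' GA'; apply: etrans (esym (h A')); exact: indepG.
move=> _; apply: (@le_lt_trans _ _ 1%E); last by rewrite ltry.
by apply: probability_le1; rewrite setTI.
Qed.

(** Independence says that the law of w -> (w, X w) on [TG * nat] is the product of its marginals;
    Tonelli's theorem then integrates the second variable first. *)
Lemma freezing (phi : TG * nat -> \bar R) : measurable_fun setT phi ->
  (forall z, (0 <= phi z)%E) ->
  (\int[P]_w phi (w, X w) = \int[P]_w \int[distribution P X]_x phi (w, x))%E.
Proof.
move=> mphi phi0.
have mpair : measurable_fun setT (fun w => (idG w, X w)).
  by apply: measurable_fun_pair.
pose PG := distribution P (mfun_Sub (mem_set midG) : {mfun T >-> TG}).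
pose pair := mfun_Sub (mem_set mpair) : {mfun T >-> (TG * nat)%type}.
pose m' := distribution P pair.
have eqm A : measurable A -> (PG \x distribution P X)%E A = m' A.
  move=> mA; apply: (product_measure_unique (m' := m')) => // B C mB mC.
  exact: (sub_sigma_independent C mB).
transitivity (\int[m']_z phi z)%E.
  by rewrite /m' ge0_integral_distribution.
transitivity (\int[(PG \x distribution P X)%E]_z phi z)%E.
  by apply: eq_measure_integral => A mA _; exact: (esym (eqm A mA)).
rewrite fubini_tonelli1// /PG ge0_integral_distribution//.
  exact: measurable_fun_fubini_tonelli_F.
by move=> w; apply: integral_ge0.
Qed.

End freezing.

(** Meant for squares of truncated sums: these are eventually constant at each point but not
    monotone in the truncation. *)
Lemma fatou_le d (T : measurableType d) (R : realType)
    (mu : {measure set T -> \bar R}) (f_ : nat -> T -> \bar R) (f : T -> \bar R)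
    (B : \bar R) :
  (forall n, measurable_fun setT (f_ n)) -> (forall n w, (0 <= f_ n w)%E) ->
  (forall w, \forall n \near \oo, f_ n w = f w) ->
  (forall n, (\int[mu]_w f_ n w <= B)%E) -> (\int[mu]_w f w <= B)%E.
Proof.
move=> mf f0 ff fB.
have cv w : f_ n w @[n --> \oo] --> f w by apply: cvg_near_cst; exact: ff.
rewrite (_ : (\int[mu]_w f w)%E = (\int[mu]_w limn_einf (f_^~ w))%E); last first.
  by apply: eq_integral => w _; rewrite (cvg_limn_einf_sup (cv w)).1.
have := @fatou _ _ R mu setT measurableT f_ (fun n => mf n) (fun n w _ => f0 n w).
move=> /le_trans; apply.
rewrite limn_einf_lim; apply: lime_le; first exact: is_cvg_einfs.
apply: nearW => n; apply: le_trans (fB n).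
by apply: ereal_inf_lbound; exists n => //=.
Qed.

Section second_moment.
Context (R : realType) (nu : probability nat R) (a v : R).
Hypothesis nu1 : (\int[nu]_x (x%:R)%:E = a%:E)%E.
Hypothesis nu2 : (\int[nu]_x ((x%:R - a) ^+ 2)%:E = v%:E)%E.

Lemma nat_measurable d (U : measurableType d) (h : nat -> U) : measurable_fun setT h.
Proof. by []. Qed.

(** The cross term vanishes because a is the mean of [nu]. *)
Lemma second_moment_affine (u h : R) :
  (\int[nu]_x ((u + h * (x%:R - a)) ^+ 2)%:E = (u ^+ 2 + v * h ^+ 2)%:E)%E.
Proof.
have i1 : nu.-integrable setT (EFin \o (fun x : nat => x%:R)).
  apply/integrableP; split; first exact/measurable_EFinP/nat_measurable.
  rewrite [ltLHS](_ : _ = a%:E) ?ltry//.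
  by rewrite -nu1; apply: eq_integral => x _ /=; rewrite ger0_norm.
have i2 : nu.-integrable setT (EFin \o (fun x : nat => (x%:R - a) ^+ 2)).
  apply/integrableP; split; first exact/measurable_EFinP/nat_measurable.
  rewrite [ltLHS](_ : _ = v%:E) ?ltry//.
  by rewrite -nu2; apply: eq_integral => x _ /=; rewrite ger0_norm// sqr_ge0.
have ic c : nu.-integrable setT (EFin \o (cst c : nat -> R)).
  by apply: (bounded_integrable nu (M := `|c|)) => //; exact: nat_measurable.
have i1' : nu.-integrable setT (EFin \o (fun x : nat => 2 * u * h * (x%:R - a))).
  exact: (integrableZl measurableT (2 * u * h) (integrableB measurableT i1 (ic a))).
have i2' : nu.-integrable setT (EFin \o (fun x : nat => h ^+ 2 * (x%:R - a) ^+ 2)).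
  exact: (integrableZl measurableT (h ^+ 2) i2).
have is' := integrableD measurableT (integrableD measurableT (ic (u ^+ 2)) i1') i2'.
rewrite [LHS](_ : _ =
    (\int[nu]_x (u ^+ 2 + 2 * u * h * (x%:R - a) + h ^+ 2 * (x%:R - a) ^+ 2)%:E)%E); last first.
  by apply: eq_integral => x _; congr EFin; ring.
rewrite -[LHS]fineK; last exact: (integrable_fin_num measurableT is').
rewrite -/(Rintegral _ _ _); congr EFin.
rewrite RintegralD//; last exact: (integrableD measurableT (ic (u ^+ 2)) i1').
have iB := integrableB measurableT i1 (ic a).
have e0 : \int[nu]_x (u ^+ 2) = u ^+ 2.
  by rewrite Rintegral_cst// [X in fine X](@probability_setT _ _ _ nu) mulr1.
have e1 : \int[nu]_x (2 * u * h * (x%:R - a)) = 0.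
  apply: etrans (RintegralZl (2 * u * h) measurableT iB) _.
  rewrite [X in _ * X](_ : _ = 0) ?mulr0//.
  apply: etrans (RintegralB measurableT i1 (ic a)) _.
  rewrite Rintegral_cst// [X in fine X](@probability_setT _ _ _ nu) mulr1.
  by rewrite /Rintegral nu1 subrr.
have e2 : \int[nu]_x (h ^+ 2 * (x%:R - a) ^+ 2) = h ^+ 2 * v.
  apply: etrans (RintegralZl (h ^+ 2) measurableT i2) _.
  by rewrite /Rintegral nu2.
rewrite RintegralD//; last exact: ic.
apply: etrans (congr2 +%R (congr2 +%R e0 e1) e2) _; ring.
Qed.

Lemma first_moment_affine (u h : R) : 0 <= u -> 0 <= h ->
  (\int[nu]_x (u + h * x%:R)%:E = (u + h * a)%:E)%E.
Proof.
move=> u0 h0.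
under eq_integral do rewrite EFinD EFinM.
rewrite ge0_integralD//=; [|by move=> x _; rewrite mule_ge0].
rewrite ge0_integralZl// nu1 integral_cst// [X in (_ * X)%E](@probability_setT _ _ _ nu).
by rewrite mule1 EFinD EFinM.
Qed.

End second_moment.

(* A random sum over one generation, whose terms are revealed one at a time:
   G j is the information available before X j. *)
Section random_sum_moments.
Context d (T : measurableType d) (R : realType) (P : probability T R).
Variables (X : nat -> {RV P >-> nat}) (X0 : {RV P >-> nat}) (G : nat -> set (set T)).
Hypothesis Gmeas : forall j, G j `<=` measurable.
Hypothesis GT : forall j, G j setT.
Hypothesis GI : forall j, setI_closed (G j).
Hypothesis indepG : forall j A B, G j A ->
  P (A `&` X j @^-1` B) = (P A * P (X j @^-1` B))%E.
Hypothesis lawX : forall j B, distribution P (X j) B = distribution P X0 B.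
Variable a : R.
Hypothesis meanX : (\int[distribution P X0]_x (x%:R)%:E = a%:E)%E.

Let TG j := g_sigma_algebraType (G j).

Definition adapted d' (U : measurableType d') j (f : T -> U) :=
  @measurable_fun _ _ (TG j) U setT f.

Hypothesis adaptedX : forall i j, (i < j)%N -> adapted j (X i : T -> nat).

Lemma adapted_measurable d' (U : measurableType d') j (f : T -> U) :
  adapted j f -> measurable_fun setT f.
Proof.
by move=> mf _ A mA; exact: (sub_sigma_measurable (Gmeas (j := j)) (mf measurableT A mA)).
Qed.

Lemma freezing_X0 j (phi : TG j * nat -> \bar R) : measurable_fun setT phi ->
  (forall z, (0 <= phi z)%E) ->
  (\int[P]_w phi (w, X j w) = \int[P]_w \int[distribution P X0]_x phi (w, x))%E.
Proof.
move=> mphi phi0; rewrite (freezing (Gmeas (j := j)) (GT j) (GI (j := j)) (indepG (j := j)))//.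
apply: eq_integral => w _; apply: eq_measure_integral => A _ _; exact: lawX.
Qed.

Variable V : T -> nat.
Hypothesis adaptedV : forall j, adapted j V.

Let adapted_lt j : adapted j (fun w => (j < V w)%N%:R : R).
Proof. exact: (@measurable_fun_nat _ (TG j) _ _ (fun v => (j < v)%N%:R : R) _ (@adaptedV j)). Qed.

Let adapted_sum (f : nat -> R) j :
  adapted j (fun w => \sum_(0 <= i < minn (V w) j) f (X i w)).
Proof.
apply: (@measurable_fun_nat_index _ (TG j) _ _ V
  (fun v w => \sum_(0 <= i < minn v j) f (X i w))); first exact: adaptedV.
move=> v; elim: (minn v j) (geq_minr v j) => [|k IH] kj.
  by apply: (eq_measurable_fun (cst (0 : R))) => // w _; rewrite big_geq.
rewrite (_ : (fun w => _) = (fun w => \sum_(0 <= i < k) f (X i w) + f (X k w))).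
  2: by apply/funext => w; rewrite big_nat_recr.
apply: measurable_funD; first by apply: IH; exact: ltnW.
exact: (@measurable_fun_nat _ (TG j) _ _ f _ (adaptedX kj)).
Qed.

Let sum_minS (f : nat -> T -> R) j w : \sum_(0 <= i < minn (V w) j.+1) f i w =
  \sum_(0 <= i < minn (V w) j) f i w + (j < V w)%N%:R * f j w.
Proof.
have [jV|Vj] := ltnP j (V w).
  by rewrite (minn_idPr jV) big_nat_recr//= mul1r.
by rewrite (minn_idPl (leqW Vj)) mul0r addr0.
Qed.

Let measurable_minn j : measurable_fun setT (fun w => (minn (V w) j)%:R : R).
Proof.
apply: (adapted_measurable (j := 0%N)).
exact: (@measurable_fun_nat _ (TG 0) _ _ (fun v => (minn v j)%:R : R) _ (@adaptedV 0%N)).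
Qed.

Let measurable_V : measurable_fun setT (fun w => (V w)%:R : R).
Proof.
apply: (adapted_measurable (j := 0%N)).
exact: (@measurable_fun_nat _ (TG 0) _ _ (fun v => v%:R : R) _ (@adaptedV 0%N)).
Qed.

(** A form of Wald's identity. Whether the term of index j enters the sum, j < V, is known before
    [X j], so this term contributes a times the probability of entering. *)
Lemma random_sum_mean_le :
  (\int[P]_w (\sum_(0 <= i < V w) (X i w)%:R)%:E <= a%:E * \int[P]_w ((V w)%:R)%:E)%E.
Proof.
have a0 : 0 <= a by rewrite -lee_fin -meanX; apply: integral_ge0 => x _; rewrite lee_fin.
pose S j w : R := \sum_(0 <= i < minn (V w) j) (X i w)%:R.
have S0 j w : 0 <= S j w by apply: sumr_ge0 => i _; exact: ler0n.
have mS j : adapted j (S j) by exact: (adapted_sum (fun x => x%:R : R)).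
apply: (@fatou_le _ _ _ _ (fun j w => (S j w)%:E)).
- by move=> j; apply/measurable_EFinP; exact: adapted_measurable.
- by move=> j w; rewrite lee_fin.
- by move=> w; exists (V w) => // j /= Vj; rewrite /S (minn_idPl Vj).
move=> j; apply: (@le_trans _ _ (a%:E * \int[P]_w ((minn (V w) j)%:R)%:E)%E); last first.
  apply: lee_wpmul2l => //; apply: ge0_le_integral => //.
  - exact/measurable_EFinP/measurable_minn.
  - exact/measurable_EFinP/measurable_V.
  - by move=> w _; rewrite lee_fin ler_nat geq_minl.
elim: j => [|j IH].
  rewrite (eq_integral (cst 0%E)) ?integral0; last first.
    by move=> w _; rewrite /S minn0 big_geq.
  by apply: mule_ge0 => //; apply: integral_ge0 => w _; rewrite lee_fin.
(* The first argument carries what is known at stage j; the second stands for the next variable, to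
   be integrated out. *)
pose phi (z : TG j * nat) := (S j z.1 + (j < V z.1)%N%:R * z.2%:R)%:E.
have mphi : measurable_fun setT phi.
  apply/measurable_EFinP; apply: measurable_funD.
    exact: (measurableT_comp (@mS j) measurable_fst).
  apply: measurable_funM; first exact: (measurableT_comp (@adapted_lt j) measurable_fst).
  exact: (measurable_fun_nat (fun x => x%:R : R) measurable_snd).
have phi0 z : (0 <= phi z)%E by rewrite lee_fin addr_ge0 ?mulr_ge0.
rewrite (_ : (\int[P]_w (S j.+1 w)%:E)%E = (\int[P]_w phi (w, X j w))%E); last first.
  by apply: eq_integral => w _; rewrite /S (sum_minS (fun i w => (X i w)%:R)).
rewrite freezing_X0//.
under eq_integral do rewrite /phi /= (first_moment_affine meanX)//.
rewrite [leLHS](_ : _ =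
  (\int[P]_w ((S j w)%:E + a%:E * ((j < V w)%N%:R)%:E))%E); last first.
  by apply: eq_integral => w _; rewrite EFinD EFinM muleC.
have mlt : measurable_fun setT (fun w => ((j < V w)%N%:R : R)%:E).
  by apply/measurable_EFinP; exact: adapted_measurable (@adapted_lt j).
rewrite ge0_integralD//=; first last.
- exact: measurable_funeM.
- by move=> w _; rewrite mule_ge0.
- by apply/measurable_EFinP; exact: adapted_measurable (@mS j).
- by move=> w _; rewrite lee_fin.
apply: le_trans (leeD IH (lexx _)) _.
rewrite ge0_integralZl// -ge0_muleDr; [|exact: integral_ge0..].
apply: lee_wpmul2l => //; rewrite -ge0_integralD//=; last exact/measurable_EFinP.
rewrite le_eqVlt; apply/orP; left; apply/eqP; apply: eq_integral => w _.
rewrite -EFinD -natrD; congr (_%:R%:E).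
case: ltnP => [jV|Vj]; first by rewrite (minn_idPr jV) addn1.
by rewrite (minn_idPl (leqW Vj)) addn0.
Qed.

Variable v : R.
Hypothesis varX : (\int[distribution P X0]_x ((x%:R - a) ^+ 2)%:E = v%:E)%E.

Variables U H : T -> R.
Hypothesis adaptedU : forall j, adapted j U.
Hypothesis adaptedH : forall j, adapted j H.

(** Orthogonality of increments: U, H, V and the earlier terms are known when [X j] is integrated
    out, so each term that enters adds v H^2 and no cross term. *)
Lemma random_sum_second_moment_le :
  (\int[P]_w ((U w + H w * \sum_(0 <= i < V w) ((X i w)%:R - a)) ^+ 2)%:E <=
   \int[P]_w (U w ^+ 2)%:E + v%:E * \int[P]_w (H w ^+ 2 * (V w)%:R)%:E)%E.
Proof.
have v0 : 0 <= v.
  by rewrite -lee_fin -varX; apply: integral_ge0 => x _; rewrite lee_fin sqr_ge0.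
pose S j w : R := U w + H w * \sum_(0 <= i < minn (V w) j) ((X i w)%:R - a).
have mS j : adapted j (S j).
  apply: measurable_funD; first exact: adaptedU.
  apply: measurable_funM; first exact: adaptedH.
  exact: (adapted_sum (fun x => x%:R - a : R)).
have mS2 j : adapted j (fun w => S j w ^+ 2) by apply: measurable_funX; exact: mS.
have mH2 : measurable_fun setT (fun w => H w ^+ 2).
  by apply: measurable_funX; exact: adapted_measurable (@adaptedH 0%N).
apply: (@fatou_le _ _ _ _ (fun j w => (S j w ^+ 2)%:E)).
- by move=> j; apply/measurable_EFinP; exact: adapted_measurable (@mS2 j).
- by move=> j w; rewrite lee_fin sqr_ge0.
- by move=> w; exists (V w) => // j /= Vj; rewrite /S (minn_idPl Vj).
move=> j; apply: (@le_trans _ _ (\int[P]_w (U w ^+ 2)%:E +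
    v%:E * \int[P]_w (H w ^+ 2 * (minn (V w) j)%:R)%:E)%E); last first.
  apply: leeD => //; apply: lee_wpmul2l => //; apply: ge0_le_integral => //.
  - by move=> w _; rewrite lee_fin mulr_ge0 ?sqr_ge0.
  - by apply/measurable_EFinP; apply: measurable_funM => //; exact: measurable_minn.
  - by apply/measurable_EFinP; apply: measurable_funM => //; exact: measurable_V.
  - by move=> w _; rewrite lee_fin ler_wpM2l ?sqr_ge0// ler_nat geq_minl.
elim: j => [|j IH].
  rewrite [leLHS](_ : _ = (\int[P]_w (U w ^+ 2)%:E)%E); last first.
    by apply: eq_integral => w _; rewrite /S minn0 big_geq// mulr0 addr0.
  rewrite leeDl// mule_ge0//; apply: integral_ge0 => w _.
  by rewrite lee_fin mulr_ge0 ?sqr_ge0.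
pose phi (z : TG j * nat) :=
  ((S j z.1 + (H z.1 * (j < V z.1)%N%:R) * (z.2%:R - a)) ^+ 2)%:E.
have mphi : measurable_fun setT phi.
  apply/measurable_EFinP; apply: measurable_funX; apply: measurable_funD.
    exact: (measurableT_comp (@mS j) measurable_fst).
  apply: measurable_funM.
    apply: measurable_funM; first exact: (measurableT_comp (@adaptedH j) measurable_fst).
    exact: (measurableT_comp (@adapted_lt j) measurable_fst).
  exact: (measurable_fun_nat (fun x => x%:R - a : R) measurable_snd).
have phi0 z : (0 <= phi z)%E by rewrite lee_fin sqr_ge0.
rewrite [leLHS](_ : _ = (\int[P]_w phi (w, X j w))%E); last first.
  apply: eq_integral => w _.
  by rewrite /S (sum_minS (fun i w => (X i w)%:R - a)) mulrDr mulrA addrA.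
rewrite freezing_X0//.
under eq_integral do rewrite /phi /= (second_moment_affine meanX varX)//.
rewrite [leLHS](_ : _ =
  (\int[P]_w ((S j w ^+ 2)%:E + v%:E * (H w ^+ 2 * (j < V w)%N%:R)%:E))%E); last first.
  apply: eq_integral => w _; rewrite EFinD EFinM exprMn.
  by case: (j < V w)%N; rewrite /= ?expr1n// expr0n.
have mlt : measurable_fun setT (fun w => (H w ^+ 2 * (j < V w)%N%:R)%:E).
  apply/measurable_EFinP; apply: measurable_funM => //.
  exact: adapted_measurable (@adapted_lt j).
have mmin : measurable_fun setT (fun w => (H w ^+ 2 * (minn (V w) j)%:R)%:E).
  by apply/measurable_EFinP; apply: measurable_funM => //; exact: measurable_minn.
have H0 w (b : nat) : (0 <= (H w ^+ 2 * b%:R)%:E)%E by rewrite lee_fin mulr_ge0 ?sqr_ge0.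
rewrite ge0_integralD//=; first last.
- exact: measurable_funeM.
- by move=> w _; rewrite mule_ge0.
- by apply/measurable_EFinP; exact: adapted_measurable (@mS2 j).
- by move=> w _; rewrite lee_fin sqr_ge0.
apply: le_trans (leeD IH (lexx _)) _.
rewrite ge0_integralZl// -addeA -ge0_muleDr; [|by apply: integral_ge0..].
apply: leeD => //; apply: lee_wpmul2l => //; rewrite -ge0_integralD//=.
rewrite le_eqVlt; apply/orP; left; apply/eqP; apply: eq_integral => w _.
rewrite -EFinD -mulrDr -natrD; congr (_ * _%:R)%:E.
case: ltnP => [jV|Vj]; first by rewrite (minn_idPr jV) addn1.
by rewrite (minn_idPl (leqW Vj)) addn0.
Qed.

End random_sum_moments.

(** * The Galton-Watson process *)

Section past.
Context d (T : measurableType d) (R : realType) (P : probability T R).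
Variables (I : choiceType) (D : set I) (X : I -> {RV P >-> nat})
  (I' : Type) (Y : I' -> {RV P >-> nat}).
Hypothesis indepX : mutually_independent D X.
Hypothesis indepXY : independent_families D X setT Y.

(** A pi-system generating the information in the X i, i in E, and in the whole of Y. The product
    form lets independence be read off from the hypotheses without describing the generated
    sigma-algebra. *)
Definition past (E : set I) : set (set T) :=
  [set A | exists (J : {fset I}) (a : I -> set nat) (B : set T),
    [/\ forall i, i \in J -> E i, sigma_of setT Y B &
        A = \bigcap_(i in [set` J]) (X i @^-1` a i) `&` B] ].

Let mX i (a : set nat) : measurable (X i @^-1` a).
Proof. by rewrite -[X in measurable X]setTI; exact: (measurable_funPT (X i)). Qed.

Let mcap (J : {fset I}) (a : I -> set nat) :
  measurable (\bigcap_(i in [set` J]) (X i @^-1` a i)).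
Proof. by apply: fin_bigcap_measurable => // i _; exact: mX. Qed.

Lemma sigma_of_measurable B : sigma_of setT Y B -> measurable B.
Proof.
apply: sub_sigma_measurable => _ [i _ [A _ <-]].
by rewrite -[X in measurable X]setTI; exact: (measurable_funPT (Y i)).
Qed.

Lemma past_measurable E : past E `<=` measurable.
Proof.
move=> _ [J [a [B [_ sB ->]]]]; apply: measurableI; first exact: mcap.
exact: sigma_of_measurable.
Qed.

Lemma pastT E : past E setT.
Proof.
exists fset0, (fun=> setT), setT; split => //.
  exact: (@measurableT _ (g_sigma_algebraType _)).
by apply/seteqP; split => // w _; split.
Qed.

Lemma past_setI E : setI_closed (past E).
Proof.
move=> _ _ [J [a [B [JE sB ->]]]] [J' [a' [B' [JE' sB' ->]]]].
exists (J `|` J')%fset, (fun i => (if i \in J then a i else setT) `&`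
  (if i \in J' then a' i else setT)), (B `&` B'); split.
- by move=> i; rewrite inE => /orP[/JE|/JE'].
- exact: (@measurableI _ (g_sigma_algebraType _) _ _ sB sB').
- apply/seteqP; split=> w.
    move=> [[Jw Bw] [J'w B'w]]; split=> // i /=; rewrite inE => iJ; split.
      by case: ifPn => // iJ0; exact: Jw.
    by case: ifPn => // iJ0; exact: J'w.
  move=> [Jw [Bw B'w]]; split; split => // i /= iJ.
    by have [|] := Jw i; rewrite /= ?inE iJ.
  by have [|_] := Jw i; rewrite /= ?inE iJ ?orbT.
Qed.

(** The cylinder C, with or without the condition on [X k], belongs to the sigma-algebra of X, so
    the event of Y factors out first. Mutual independence then separates [X k] from C. *)
Lemma past_independent E k A b : E `<=` D -> D k -> ~ E k -> past E A ->
  P (A `&` X k @^-1` b) = (P A * P (X k @^-1` b))%E.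
Proof.
move=> ED Dk nEk [J [a [B [JE sB ->]]]].
set C := \bigcap_(i in _) _.
have kJ : k \notin J by apply/negP => /JE.
pose a' i := if i == k then b else a i.
have CkE : C `&` X k @^-1` b = \bigcap_(i in [set` (k |` J)%fset]) (X i @^-1` a' i).
  apply/seteqP; split=> w.
    move=> [Cw bw] i /=; rewrite !inE => /orP[/eqP->|iJ]; rewrite /a' ?eqxx//.
    case: eqP => [ik|_]; last exact: Cw.
    by rewrite -ik iJ in kJ.
  move=> h; split; last by have := h k; rewrite /= !inE eqxx /a' eqxx; apply.
  move=> i /= iJ; have := h i; rewrite /= !inE iJ orbT /a'.
  case: eqP => [ik|_]; last by apply.
  by rewrite -ik iJ in kJ.
have JD i : i \in J -> D i by move=> /JE/ED.
have sC (J0 : {fset I}) a0 : (forall i, i \in J0 -> D i) ->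
    sigma_of D X (\bigcap_(i in [set` J0]) (X i @^-1` a0 i)).
  move=> J0D; apply: (@fin_bigcap_measurable _ (g_sigma_algebraType _)) => // i iJ.
  by apply: sub_sigma_algebra; exists i; [exact: J0D|exists (a0 i)].
have PCB : P (C `&` B) = (P C * P B)%E by apply: indepXY => //; exact: sC.
have PCk : P (C `&` X k @^-1` b) = (P C * P (X k @^-1` b))%E.
  rewrite CkE indepX; last 2 first.
  - by move=> i; rewrite !inE => /orP[/eqP->//|/JD].
  - by [].
  rewrite big_fsetU1//= /a' eqxx muleC; congr (_ * _)%E.
  rewrite /C indepX//; apply: eq_big_seq => i iJ.
  by case: eqP => // ik; rewrite -ik iJ in kJ.
rewrite setIAC indepXY//; last first.
  by rewrite CkE; apply: sC => i; rewrite !inE => /orP[/eqP->//|/JD].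
by rewrite [X in (X * _)%E]PCk PCB muleAC.
Qed.

Let TG E := g_sigma_algebraType (past E).

Lemma past_X E k : E k -> @measurable_fun _ _ (TG E) _ setT (X k : T -> nat).
Proof.
move=> Ek _ b mb; rewrite setTI; apply: sub_sigma_algebra.
exists [fset k]%fset, (fun=> b), setT; split.
- by move=> i; rewrite inE => /eqP->.
- exact: (@measurableT _ (g_sigma_algebraType _)).
- rewrite setIT; apply/seteqP; split=> [w bw i /=|w h]; last by apply: (h k); rewrite /= inE.
  by rewrite inE => /eqP ->.
Qed.

Lemma past_Y E k : @measurable_fun _ _ (TG E) _ setT (Y k : T -> nat).
Proof.
move=> _ b mb; rewrite setTI; apply: sub_sigma_algebra.
exists fset0, (fun=> setT), (Y k @^-1` b); split => //.
- by apply: sub_sigma_algebra; exists k => //; exists b.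
- by apply/seteqP; split => [w bw|w []//]; split.
Qed.

End past.

(** * The stopped martingale *)

Section stopped_noise.
Context {R : realType} {T : Type} (a c : R) (b : nat -> R)
  (x : nat -> nat -> T -> nat) (X : nat -> T -> nat).

Definition noise k w : R :=
  \sum_(0 <= i < X k w) ((x k.+1 i.+1 w)%:R - a).

(** Stopping is written as a coefficient that depends on the previous value only, hence is known
    before the new generation is revealed. *)
Fixpoint stopped_noise k w : R :=
  if k is k'.+1 then stopped_noise k' w +
    (if `|stopped_noise k' w| < c then b k else 0) * noise k' w
  else 0.

(** Once the level c is reached all further coefficients vanish, so the final value retains the
    excess. A Chebyshev bound at time K thereby controls the maximum over all earlier times. *)
Lemma stopped_noise_lt K w : `|stopped_noise K w| < c ->
  forall k, (k <= K)%N -> `|stopped_noise k w| < c.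
Proof.
elim: K => [|K IH] SK k; first by rewrite leqn0 => /eqP->.
rewrite leq_eqVlt => /predU1P[->//|]; rewrite ltnS; apply: IH.
by apply: contraLR SK => nSK /=; rewrite (negbTE nSK) mul0r addr0.
Qed.

Lemma stopped_noiseE K w : `|stopped_noise K w| < c ->
  forall k, (k <= K)%N -> stopped_noise k w = \sum_(0 <= l < k) b l.+1 * noise l w.
Proof.
move=> SK; elim=> [|k IH] kK; first by rewrite big_geq.
by rewrite big_nat_recr//= (stopped_noise_lt SK (ltnW kK)) IH// ltnW.
Qed.

End stopped_noise.

Section branching_measurability.
Context d (T : measurableType d) (R : realType) (a c : R) (b : nat -> R)
  (x : nat -> nat -> T -> nat) (Y : nat -> T -> nat) (X : nat -> T -> nat) (k : nat).
Hypothesis X0 : forall w, X 0%N w = 0%N.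
Hypothesis XS : forall k w,
  X k.+1 w = (\sum_(0 <= i < X k w) x k.+1 i.+1 w + Y k w)%N.
Hypothesis mx : forall l i, (0 < l <= k)%N -> (0 < i)%N -> measurable_fun setT (x l i).
Hypothesis mY : forall l, measurable_fun setT (Y l).

(** The measurable space is arbitrary so that T can be equipped with the sigma-algebra of the past;
    only generations up to k are used. *)
Lemma branching_measurable : measurable_fun setT (X k).
Proof.
have : (k <= k)%N by [].
elim: {1 3}k => [|l IH] lk.
  by apply: (eq_measurable_fun (cst 0%N)) => // w _; rewrite X0.
apply: (eq_measurable_fun (fun w => (\sum_(0 <= i < X l w) x l.+1 i.+1 w + Y l w)%N)).
  by move=> w _; rewrite XS.
apply: measurable_fun_nat2 => //.
apply: (measurable_fun_nat_index (s := fun v w => (\sum_(0 <= i < v) x l.+1 i.+1 w)%N)).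
  by apply: IH; exact: ltnW.
by move=> v; apply: measurable_fun_sumn => i _; exact: mx.
Qed.

End branching_measurability.

Section stopped_noise_measurability.
Context d (T : measurableType d) (R : realType) (a c : R) (b : nat -> R)
  (x : nat -> nat -> T -> nat) (X : nat -> T -> nat) (k : nat).
Hypothesis mX : forall l, (l < k)%N -> measurable_fun setT (X l).
Hypothesis mx : forall l i, (0 < l <= k)%N -> (0 < i)%N -> measurable_fun setT (x l i).

Lemma stopped_noise_measurable :
  measurable_fun setT (stopped_noise a c b x X k : T -> R).
Proof.
have : (k <= k)%N by [].
elim: {1 3}k => [|l IH] lk /=; first exact: measurable_cst.
have mS := IH (ltnW lk).
apply: measurable_funD => //; apply: measurable_funM.
  apply: measurable_fun_ifT => //.
  by apply: measurable_fun_ltr => //; exact: measurableT_comp.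
apply: (measurable_fun_nat_index (V := X l)
  (s := fun v w => \sum_(0 <= i < v) ((x l.+1 i.+1 w)%:R - a) : R)); first exact: mX.
elim=> [|v IHv]; first by apply: (eq_measurable_fun (cst (0 : R))) => // w _; rewrite big_geq.
rewrite (_ : (fun w => _) =
  (fun w => \sum_(0 <= i < v) ((x l.+1 i.+1 w)%:R - a) + ((x l.+1 v.+1 w)%:R - a))).
  2: by apply/funext => w; rewrite big_nat_recr.
apply: measurable_funD => //.
exact: (measurable_fun_nat (fun n => n%:R - a : R) (mx _ _)).
Qed.

End stopped_noise_measurability.

Fixpoint linear_recursion (R : pzRingType) (a : R) (y : nat -> R) k : R :=
  if k is k'.+1 then a * linear_recursion a y k' + y k' else 0.

Section GW_estimates.
Context d (Omega : measurableType d) (R : realType) (P : probability Omega R)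
  (xi : nat -> nat -> {RV P >-> nat}) (Y : nat -> {RV P >-> nat})
  (X : nat -> Omega -> nat).
Hypothesis GW : GW_immigration xi Y X.
Variables a v : R.
Hypothesis xi_mean : (\int[distribution P (xi 1 1)]_x (x%:R)%:E = a%:E)%E.
Hypothesis xi_var : (\int[distribution P (xi 1 1)]_x ((x%:R - a) ^+ 2)%:E = v%:E)%E.

Let D := [set kj : nat * nat | (0 < kj.1)%N && (0 < kj.2)%N].
Let xi2 := fun kj : nat * nat => xi kj.1 kj.2.

Lemma GW_X0 w : X 0%N w = 0%N. Proof. by have [_ _ _ ->] := GW. Qed.

Lemma GW_XS k w : X k.+1 w = (\sum_(0 <= i < X k w) xi k.+1 i.+1 w + Y k w)%N.
Proof. by have [_ _ _ _ ->] := GW; rewrite //= big_add1. Qed.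

(** Offspring variables are revealed in lexicographic order, and [xi k.+1 j.+1] comes next after
    these. *)
Let known k j := [set li : nat * nat | [&& (0 < li.1)%N, (0 < li.2)%N &
  (li.1 <= k)%N || ((li.1 == k.+1) && (li.2 <= j)%N)]].

Let G k j := past xi2 Y (known k j).

Let known_sub k j : known k j `<=` D.
Proof. by move=> [l i] /and3P[l0 i0 _]; apply/andP. Qed.

Let G_measurable k j : G k j `<=` measurable. Proof. exact: past_measurable. Qed.
Let GT k j : G k j setT. Proof. exact: pastT. Qed.
Let GI k j : setI_closed (G k j). Proof. exact: past_setI. Qed.

Let G_indep k j A B : G k j A ->
  P (A `&` xi k.+1 j.+1 @^-1` B) = (P A * P (xi k.+1 j.+1 @^-1` B))%E.
Proof.
have [_ ixi ixiY _ _] := GW; move=> GA.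
apply: (past_independent (k := (k.+1, j.+1)) ixi ixiY B _ _ _ GA) => //.
by rewrite /known /= ltnn ltnn andbF.
Qed.

Let law k j B : distribution P (xi k.+1 j.+1) B = distribution P (xi 1 1) B.
Proof. by have [-> ] := GW. Qed.

Let adapted_xi k i j : (i < j)%N -> adapted (G k) j (xi k.+1 i.+1 : Omega -> nat).
Proof.
move=> ij; apply: (@past_X _ _ _ P _ xi2 _ Y (known k j) (k.+1, i.+1)).
by rewrite /known /= eqxx ij orbT.
Qed.

Let adapted_xi_past k j l i : (0 < l <= k)%N -> (0 < i)%N ->
  adapted (G k) j (xi l i : Omega -> nat).
Proof.
move=> /andP[l0 lk] i0; apply: (@past_X _ _ _ P _ xi2 _ Y (known k j) (l, i)).
by rewrite /known /= l0 i0 lk.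
Qed.

Let adapted_X k l j : (l <= k)%N -> adapted (G k) j (X l).
Proof.
move=> lk; apply: (@branching_measurable _ (g_sigma_algebraType (G k j))
  (fun l i => xi l i) (fun l => Y l) X l GW_X0 GW_XS).
  move=> l' i /andP[l'0 l'l] i0; apply: adapted_xi_past => //.
  by rewrite l'0 (leq_trans l'l lk).
by move=> l'; exact: past_Y.
Qed.

Lemma GW_measurable k : measurable_fun setT (X k).
Proof. exact: (adapted_measurable (@G_measurable k) (@adapted_X k k 0%N (leqnn k))). Qed.

Let natR_measurable (V : Omega -> nat) : measurable_fun setT V ->
  measurable_fun setT (fun w => ((V w)%:R : R)%:E).
Proof.
by move=> mV; apply/measurable_EFinP; exact: (measurable_fun_nat (fun n => n%:R : R) mV).
Qed.

Lemma GW_mean_step k : (\int[P]_w ((X k.+1 w)%:R)%:E <=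
  a%:E * \int[P]_w ((X k w)%:R)%:E + \int[P]_w ((Y k w)%:R)%:E)%E.
Proof.
pose S w := (\sum_(0 <= i < X k w) xi k.+1 i.+1 w)%N.
have mS : measurable_fun setT S.
  apply: (measurable_fun_nat_index
    (s := fun v w => (\sum_(0 <= i < v) xi k.+1 i.+1 w)%N) (GW_measurable k)).
  by move=> n; apply: measurable_fun_sumn.
rewrite [leLHS](_ : _ = (\int[P]_w (((S w)%:R)%:E + ((Y k w)%:R)%:E))%E); last first.
  by apply: eq_integral => w _; rewrite GW_XS natrD EFinD.
rewrite ge0_integralD//=; [|exact: natR_measurable..].
apply: leeD => //.
rewrite [leLHS](_ : _ =
  (\int[P]_w (\sum_(0 <= i < X k w) (xi k.+1 i.+1 w)%:R)%:E)%E); last first.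
  by apply: eq_integral => w _; rewrite /S natr_sum.
apply: (random_sum_mean_le (X := fun j => xi k.+1 j.+1) (X0 := xi 1 1)
  (@G_measurable k) (@GT k) (@GI k) (@G_indep k) (law k) xi_mean).
- exact: adapted_xi.
- by move=> j; exact: adapted_X.
Qed.

Section stopped.
Variables (c : R) (b : nat -> R).
Let S k w := stopped_noise a c b (fun l i => xi l i) X k w.

Let adapted_S k j : adapted (G k) j (S k : Omega -> R).
Proof.
apply: (@stopped_noise_measurable _ (g_sigma_algebraType (G k j))).
- by move=> l lk; apply: adapted_X; exact: ltnW.
- by move=> l i; exact: adapted_xi_past.
Qed.

Lemma stopped_noise_RV_measurable k : measurable_fun setT (S k).
Proof. exact: (adapted_measurable (@G_measurable k) (@adapted_S k 0%N)). Qed.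

(** The increment has conditional variance v H^2 X_k, where H is the stopping coefficient; H^2 <=
    b^2 removes the stopping from the bound. *)
Lemma stopped_noise_step k : (\int[P]_w (S k.+1 w ^+ 2)%:E <=
  \int[P]_w (S k w ^+ 2)%:E + (v * b k.+1 ^+ 2)%:E * \int[P]_w ((X k w)%:R)%:E)%E.
Proof.
have v0 : 0 <= v.
  by rewrite -lee_fin -xi_var; apply: integral_ge0 => x _; rewrite lee_fin sqr_ge0.
pose H w : R := if `|S k w| < c then b k.+1 else 0.
have aH j : adapted (G k) j H.
  apply: measurable_fun_ifT => //.
  apply: measurable_fun_ltr => //; apply: measurableT_comp => //; exact: adapted_S.
have := random_sum_second_moment_le (X := fun j => xi k.+1 j.+1) (X0 := xi 1 1)
  (@G_measurable k) (@GT k) (@GI k) (@G_indep k) (law k) xi_mean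
  (@adapted_xi k) (fun j => @adapted_X k k j (leqnn k)) xi_var (@adapted_S k) aH.
move=> /le_trans; apply; apply: leeD => //.
rewrite EFinM -muleA; apply: lee_wpmul2l => //.
rewrite -ge0_integralZl//=; [|exact/natR_measurable/GW_measurable|by rewrite lee_fin sqr_ge0].
apply: ge0_le_integral => //.
- by move=> w _; rewrite lee_fin mulr_ge0 ?sqr_ge0.
- apply/measurable_EFinP; apply: measurable_funM.
    by apply: measurable_funX; exact: (adapted_measurable (@G_measurable k) (@aH 0%N)).
  exact: (measurable_fun_nat (fun n => n%:R : R) (GW_measurable k)).
- by apply: measurable_funeM; exact/natR_measurable/GW_measurable.
- move=> w _; rewrite -EFinM lee_fin ler_wpM2r// /H; case: ifP => // _.
  by rewrite expr0n sqr_ge0.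
Qed.

End stopped.

End GW_estimates.

Section GW_deviation.
Context d (Omega : measurableType d) (R : realType) (P : probability Omega R)
  (xi : nat -> nat -> {RV P >-> nat}) (Y : nat -> {RV P >-> nat})
  (X : nat -> Omega -> nat).
Hypothesis GW : GW_immigration xi Y X.
Variables a v : R.
Hypothesis xi_mean : (\int[distribution P (xi 1 1)]_x (x%:R)%:E = a%:E)%E.
Hypothesis xi_var : (\int[distribution P (xi 1 1)]_x ((x%:R - a) ^+ 2)%:E = v%:E)%E.
Variables (K : nat) (B y : R).
Hypothesis a0 : 0 < a.
Hypothesis aB : forall k, (k <= K)%N -> a ^+ k <= B.
Hypothesis aVB : forall k, (k <= K)%N -> a ^- k <= B.
Hypothesis y0 : 0 <= y.
Hypothesis Ymean : forall k, (k < K)%N -> (\int[P]_w ((Y k w)%:R)%:E <= y%:E)%E.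

Let B0 : 0 <= B. Proof. by apply: le_trans (aB (leq0n K)); rewrite expr0. Qed.

Lemma GW_mean_le k : (k <= K)%N ->
  (\int[P]_w ((X k w)%:R)%:E <= (K%:R * B * y)%:E)%E.
Proof.
(* The geometric sum reproduces itself under s -> a s + 1, so the induction is run with it and the
   powers are bounded by B only once. *)
move=> kK; apply: (@le_trans _ _ ((\sum_(0 <= i < k) a ^+ i) * y)%:E); last first.
  rewrite lee_fin ler_wpM2r//.
  apply: (@le_trans _ _ (\sum_(0 <= i < k) B)).
    rewrite !big_nat; apply: ler_sum => i /andP[_ ik]; apply: aB.
    exact: leq_trans (ltnW ik) kK.
  rewrite sumr_const_nat subn0 -[B *+ k]mulr_natl; apply: ler_wpM2r => //.
  by rewrite ler_nat.
elim: k kK => [|k IH] kK.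
  rewrite big_geq// mul0r (eq_integral (cst 0%E)) ?integral0// => w _.
  by rewrite (GW_X0 GW).
apply: le_trans (GW_mean_step GW xi_mean k) _.
apply: le_trans (leeD (lee_wpmul2l _ (IH (ltnW kK))) (Ymean kK)) _.
  by rewrite lee_fin ltW.
rewrite -EFinM -EFinD lee_fin big_nat_recl// expr0.
under [in leRHS]eq_bigr do rewrite exprS.
by rewrite -mulr_sumr mulrDl mul1r mulrA addrC.
Qed.

Let noise_sum w k :
  \sum_(0 <= l < k) a ^- l.+1 * noise a (fun l i => xi l i) X l w =
  a ^- k * ((X k w)%:R - linear_recursion a (fun i => (Y i w)%:R) k).
Proof.
elim: k => [|k IH]; first by rewrite big_geq// (GW_X0 GW) subrr mulr0.
rewrite big_nat_recr//= IH (GW_XS GW) natrD natr_sum /noise sumrB sumr_const_nat subn0.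
have an : a != 0 by rewrite gt_eqF.
have akn : a ^+ k != 0 by rewrite expf_neq0.
rewrite exprS invfM -mulr_natr.
move: (\sum_(0 <= i < X k w) _) (linear_recursion _ _ _) => s z.
by field; rewrite an akn.
Qed.

(** Each of the K generations adds to the second moment at most v B^2, from the squared weight a^-k,
    times the mean population K B y: this gives K^2 B^3 v y. The factor B in the conclusion undoes
    the weight. *)
Lemma GW_deviation (c : R) : 0 < c -> exists bad : set Omega,
  [/\ measurable bad, (P bad <= (K%:R ^+ 2 * B ^+ 3 * v * y / c ^+ 2)%:E)%E &
   forall w, ~ bad w -> forall k, (k <= K)%N ->
     `|(X k w)%:R - linear_recursion a (fun i => (Y i w)%:R) k| <= B * c].
Proof.
move=> c0.
have v0 : 0 <= v.
  by rewrite -lee_fin -xi_var; apply: integral_ge0 => x _; rewrite lee_fin sqr_ge0.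
pose b l := a ^- l.
pose S k w := stopped_noise a c b (fun l i => xi l i) X k w.
have mS k : measurable_fun setT (S k) by exact: (stopped_noise_RV_measurable GW a c b k).
have S2 k : (k <= K)%N ->
    (\int[P]_w (S k w ^+ 2)%:E <= (k%:R * (v * B ^+ 2 * (K%:R * B * y)))%:E)%E.
  elim: k => [|k IH] kK.
    rewrite mul0r (eq_integral (cst 0%E)) ?integral0// => w _.
    by rewrite /S /= expr0n.
  apply: le_trans (stopped_noise_step GW xi_mean xi_var c b k) _.
  have h1 : ((v * b k.+1 ^+ 2)%:E * \int[P]_w ((X k w)%:R)%:E <=
      (v * B ^+ 2 * (K%:R * B * y))%:E)%E.
    rewrite (EFinM (v * B ^+ 2)); apply: lee_pmul.
    - by rewrite lee_fin mulr_ge0 ?sqr_ge0.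
    - by apply: integral_ge0 => w _; rewrite lee_fin.
    - rewrite lee_fin ler_wpM2l// lerXn2r ?nnegrE//; last exact: aVB.
      by rewrite /b invr_ge0 exprn_ge0// ltW.
    - by apply: GW_mean_le; exact: ltnW.
  apply: le_trans (leeD (IH (ltnW kK)) h1) _.
  by rewrite -EFinD lee_fin -natr1 mulrDl mul1r.
pose bad := [set w | c <= `|S K w|].
have mbad : measurable bad.
  have mn : measurable_fun setT (fun w => `|S K w|) by exact: measurableT_comp.
  have -> : bad = (fun w => `|S K w|) @^-1` `[c, +oo[.
    by apply/seteqP; split=> w /=; rewrite in_itv/= andbT.
  by rewrite -[X in measurable X]setTI; apply: mn.
exists bad; split => //.
  have c20 : 0 < c ^+ 2 by rewrite exprn_gt0.
  have h : ((c ^+ 2)%:E * P bad <= (K%:R * (v * B ^+ 2 * (K%:R * B * y)))%:E)%E.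
    apply: le_trans (S2 K (leqnn K)).
    rewrite -[in leLHS](setIT bad) -integral_indic// -ge0_integralZl//; last 2 first.
    - by apply/measurable_EFinP; exact: measurable_indic.
    - by rewrite lee_fin ltW.
    apply: ge0_le_integral => //.
    - by move=> w _; rewrite mule_ge0// lee_fin ltW.
    - by apply: measurable_funeM; apply/measurable_EFinP; exact: measurable_indic.
    - by apply/measurable_EFinP; exact: measurable_funX.
    - move=> w _; rewrite -EFinM lee_fin indicE.
      have [wb|wb] := boolP (w \in bad); last by rewrite mulr0 sqr_ge0.
      rewrite mulr1 -[leRHS]real_normK ?num_real// lerXn2r ?nnegrE ?(ltW c0)//.
      by rewrite inE in wb.
  have : P bad \is a fin_num by exact: fin_num_measure.
  move=> /fineK Pb; rewrite -Pb -EFinM !lee_fin in h *.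
  rewrite ler_pdivlMr// mulrC; apply: le_trans h _.
  by rewrite le_eqVlt; apply/orP; left; apply/eqP; ring.
move=> w wb k kK.
have SK : `|S K w| < c by rewrite ltNge; exact/negP.
have := stopped_noise_lt SK kK.
rewrite (stopped_noiseE SK kK) noise_sum normrM gtr0_norm; last first.
  by rewrite invr_gt0 exprn_gt0.
rewrite mulrC ltr_pdivrMr ?exprn_gt0// => h; apply: le_trans (ltW h) _.
by rewrite mulrC ler_wpM2r ?(ltW c0)//; exact: aB.
Qed.

End GW_deviation.

(** * The linear recursion and its continuous limit *)

Lemma linear_recursionZ (R : realType) (a r : R) (y : nat -> R) k :
  linear_recursion a (fun i => r * y i) k = r * linear_recursion a y k.
Proof. by elim: k => [|k IH] /=; [rewrite mulr0|rewrite IH; ring]. Qed.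

Section linear_recursion_limit.
Context {R : realType} (gamma a A B K : R) (n : nat) (y : nat -> R).
Hypothesis n0 : (0 < n)%N.
Hypothesis a0 : 0 < a.
Hypothesis B1 : 1 <= B.
Hypothesis K0 : 0 < K.
Hypothesis aB : forall k, k%:R <= n%:R * K -> a ^+ k <= B.
Hypothesis yA : forall k, k%:R <= n%:R * K -> `|y k| <= A.

Let f : skorokhod R := step_path n y.
Let E : R := expR (`|gamma| * K).
Let h : R := n%:R^-1.
Let r : R := expR (gamma * h).

Let nR : 0 < n%:R :> R. Proof. by rewrite ltr0n. Qed.
Let h0 : 0 < h. Proof. by rewrite invr_gt0. Qed.
Let nh : n%:R * h = 1. Proof. by rewrite mulfV// gt_eqF. Qed.
Let A0 : 0 <= A.
Proof. by apply: le_trans (yA (k := 0%N) _) => //; rewrite mulr_ge0// ltW. Qed.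

Let fA u : 0 <= u <= K -> `|f u| <= A.
Proof.
move=> /andP[u0 uK]; apply: yA.
apply: (@le_trans _ _ (n%:R * u)); last by rewrite ler_pM2l.
by rewrite truncn_le mulr_ge0// ltW.
Qed.

Let fE k u : k%:R * h <= u -> u < k.+1%:R * h -> f u = y k.
Proof.
move=> ku uk; rewrite /f step_pathE; congr y; apply: truncn_def.
by rewrite [n%:R * u]mulrC -ler_pdivrMr// -ltr_pdivlMr// ku.
Qed.

(** On one mesh cell f is the constant y k, so the error comes only from replacing the kernel by 1
    over a length h. *)
Let conv_step k : k.+1%:R <= n%:R * K ->
  `|exp_conv gamma f (k.+1%:R * h) - (r * exp_conv gamma f (k%:R * h) + h * y k)|
  <= h * (A * (`|gamma| * h * expR (`|gamma| * h))).
Proof.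
move=> kK; set t := k.+1%:R * h; set s := k%:R * h.
have ts : t - s = h by rewrite /t /s -natr1; ring.
have s0 : 0 <= s by rewrite mulr_ge0// ltW.
have st : s <= t by rewrite -subr_ge0 ts ltW.
have tK : t <= K by rewrite /t /h ler_pdivrMr// mulrC.
have t0K : 0 <= t <= K by rewrite (le_trans s0 st).
rewrite (@exp_conv_split _ gamma f s t) ?s0// ts -/r.
have sub : [set` `]s, t[] `<=` `[0, K]%classic.
  by move=> u /=; rewrite !in_itv/= => /andP[su ut]; apply/andP; split; lra.
have subc : [set` `]s, t]] `<=` `[0, K]%classic.
  by move=> u /=; rewrite !in_itv/= => /andP[su ut]; apply/andP; split; lra.
have ik := expR_kernel_integrable gamma f t0K sub.
(* The right endpoint is dropped, as f already takes the value y (k + 1) there. *)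
rewrite -Rintegral_itv_bndo_bndc//.
have ic (C : R) : (@lebesgue_measure R).-integrable `]s, t[%classic (EFin \o cst C).
  apply: (@path_integrable _ _ _ `|C|) => //; exact: (itv_measure_fin sub).
have mst : measurable (`]s, t[%classic : set R) by exact: measurable_itv.
have Ic (C : R) : \int[lebesgue_measure]_(u in `]s, t[) C = C * h.
  rewrite (Rintegral_cst (@lebesgue_measure R) mst) /= lebesgue_measure_itv/= lte_fin.
  by rewrite -subr_gt0 ts h0 -EFinB ts.
have -> : h * y k = \int[lebesgue_measure]_(u in `]s, t[) y k by rewrite Ic mulrC.
rewrite opprD addrACA subrr add0r.
have idiff := @integrableB _ _ R (@lebesgue_measure R) _ (measurable_itv _) _ _ ik (ic (y k)).
rewrite -RintegralB//; last exact: ic.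
apply: le_trans (le_normr_Rintegral _ idiff) _; first exact: measurable_itv.
rewrite [leRHS]mulrC -Ic; apply: le_Rintegral; first exact: measurable_itv.
- exact: (integrable_norm idiff).
- exact: ic.
move=> u uI; have /andP[su ut] : s < u < t by move: uI; rewrite /= in_itv/=.
rewrite (fE (ltW su) ut) -[X in _ - X]mul1r -mulrBl normrM mulrC.
apply: ler_pM => //; first by apply: yA; apply: le_trans kK; rewrite ler_nat.
apply: le_trans (expR_sub1_le _) _; rewrite normrM (gtr0_norm (_ : 0 < t - u)) ?subr_gt0//.
have tu : t - u <= h by rewrite -ts; lra.
apply: ler_pM; [by rewrite mulr_ge0// subr_ge0 ltW|exact: expR_ge0|exact: ler_wpM2l|].
by rewrite ler_expR ler_wpM2l.
Qed.

(** The error of one step: a in place of r, acting on a convolution bounded by E A K, plus the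
    kernel error. The factor h is extracted by n h = 1, since about n K such errors add up. *)
Let eta : R := h * (A * (n%:R * `|a - r| * (E * K) + `|gamma| * h * expR (`|gamma| * h))).

Let eta0 : 0 <= eta.
Proof.
have E0 : 0 <= E by exact: expR_ge0.
rewrite /eta mulr_ge0 ?(ltW h0)// mulr_ge0// addr_ge0//.
  by rewrite !mulr_ge0// ltW.
by rewrite !mulr_ge0 ?expR_ge0// ltW.
Qed.

(** The error obeys e_(k+1) <= a e_k + eta, hence is at most eta times a geometric sum. *)
Let grid_error k : k%:R <= n%:R * K ->
  `|h * linear_recursion a y k - exp_conv gamma f (k%:R * h)| <= k%:R * B * eta.
Proof.
move=> kK; apply: (@le_trans _ _ ((\sum_(0 <= i < k) a ^+ i) * eta)); last first.
  rewrite ler_wpM2r//.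
  apply: (@le_trans _ _ (\sum_(0 <= i < k) B)).
    rewrite !big_nat; apply: ler_sum => i /andP[_ ik]; apply: aB.
    by apply: le_trans kK; rewrite ler_nat ltnW.
  by rewrite sumr_const_nat subn0 -[B *+ k]mulr_natl.
elim: k kK => [|k IH] kK; rewrite [linear_recursion _ _ _]/=.
  by rewrite big_geq// !mul0r exp_conv_le0// mulr0 subrr normr0.
have kK' : k%:R <= n%:R * K by apply: le_trans kK; rewrite ler_nat.
have h1 := conv_step kK; have h2 := IH kK'.
have khK : 0 <= k%:R * h <= K.
  by rewrite mulr_ge0 ?(ltW h0)//= /h ler_pdivrMr// mulrC.
have h3 := exp_conv_bound gamma khK fA; rewrite -/E in h3.
rewrite big_nat_recl// expr0.
under eq_bigr do rewrite exprS.
rewrite -mulr_sumr mulrDl mul1r.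
move: h1 h2 h3; set I1 := exp_conv _ _ _; set I0 := exp_conv _ _ _.
set x := linear_recursion a y k; set sg := \sum_(0 <= i < k) _ => h1 h2 h3.
have -> : h * (a * x + y k) - I1 =
  a * (h * x - I0) + (a - r) * I0 - (I1 - (r * I0 + h * y k)) by ring.
apply: le_trans (ler_normB _ _) _.
apply: le_trans (lerD (ler_normD _ _) h1) _; rewrite !normrM (gtr0_norm a0).
have h4 : a * `|h * x - I0| <= a * (sg * eta) by rewrite ler_pM2l.
have h5 : `|a - r| * `|I0| <= `|a - r| * (E * A * K) by rewrite ler_wpM2l.
apply: le_trans (lerD (lerD h4 h5) (lexx _)) _.
have key : `|a - r| * (E * A * K) +
    h * (A * (`|gamma| * h * expR (`|gamma| * h))) = eta.
  have -> : `|a - r| * (E * A * K) = (n%:R * h) * `|a - r| * (E * A * K).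
    by rewrite nh mul1r.
  by rewrite /eta; ring.
by rewrite -addrA key le_eqVlt; apply/orP; left; apply/eqP; ring.
Qed.

Lemma linear_recursion_exp_conv t : 0 <= t <= K ->
  `|h * linear_recursion a y (Num.truncn (n%:R * t)) - exp_conv gamma f t| <=
  A * (K * B * (n%:R * `|a - r| * (E * K) + `|gamma| * h * expR (`|gamma| * h)) +
       E ^+ 2 * (1 + `|gamma| * K) * h).
Proof.
move=> /andP[t0 tK]; set k := Num.truncn _.
have nt0 : 0 <= n%:R * t by rewrite mulr_ge0// ltW.
have knt : k%:R <= n%:R * t by rewrite truncn_le.
have kK : k%:R <= n%:R * K by apply: le_trans knt _; rewrite ler_pM2l.
have kht : k%:R * h <= t by rewrite /h ler_pdivrMr// mulrC.
have tkh : t - k%:R * h <= h.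
  rewrite lerBlDl; have := truncnS_gt (n%:R * t); rewrite -/k -natr1.
  rewrite -(ltr_pM2r h0) [n%:R * t]mulrC -mulrA nh mulr1 mulrDl mul1r.
  exact: ltW.
have kh0 : 0 <= k%:R * h by rewrite mulr_ge0// ltW.
have h1 := grid_error kK.
have h2 := exp_conv_lip gamma kh0 kht tK fA; rewrite -/E in h2.
rewrite -(subrK (exp_conv gamma f (k%:R * h)) (h * _)) -addrA.
apply: le_trans (ler_normD _ _) _; rewrite mulrDr; apply: lerD.
  apply: le_trans h1 _.
  have : k%:R * B * eta <= n%:R * K * B * eta.
    by rewrite ler_wpM2r// ler_wpM2r//; apply: le_trans B1.
  move=> /le_trans; apply; rewrite le_eqVlt; apply/orP; left; apply/eqP.
  rewrite /eta; transitivity ((n%:R * h) * (A * (K * B *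
    (n%:R * `|a - r| * (E * K) + `|gamma| * h * expR (`|gamma| * h))))); first by ring.
  by rewrite nh mul1r.
rewrite distrC; apply: le_trans h2 _.
have E0 : 0 <= E ^+ 2 * (1 + `|gamma| * K) * A.
  apply: mulr_ge0 => //; apply: mulr_ge0; first exact: sqr_ge0.
  by apply: addr_ge0 => //; apply: mulr_ge0 => //; exact: ltW.
apply: le_trans (ler_wpM2l E0 tkh) _.
by rewrite le_eqVlt; apply/orP; left; apply/eqP; ring.
Qed.

End linear_recursion_limit.

(** * Asymptotics of the near-critical offspring mean *)

Section near_critical_offspring_mean.
Context {R : realType}.

Lemma cvg_invn : (n%:R^-1 : R) @[n --> \oo] --> (0 : R).
Proof.
apply/cvgrPdist_le => e e0.
have /cvgrPdist_le/(_ _ e0)[N _ hN] := @cvg_harmonic R.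
exists N.+1 => // -[//|n] /= Nn.
exact: (hN n).
Qed.

Lemma expR_taylor1_le (x : R) : `|expR x - 1 - x| <= x ^+ 2 * expR `|x|.
Proof.
have e1 := expR_ge1Dx x.
rewrite ger0_norm; last by lra.
have h : expR x * (1 - x) <= 1.
  by rewrite -[leRHS]expR0 -(subrr x) expRD ler_pM2l ?expR_gt0//; exact: expR_ge1Dx.
apply: (@le_trans _ _ (x * (expR x - 1))); first lra.
apply: le_trans (ler_norm _) _; rewrite normrM -real_normK ?num_real// expr2 -mulrA.
by rewrite ler_wpM2l//; exact: expR_sub1_le.
Qed.

Variables (gamma_ : nat -> R) (gamma : R).
Hypothesis gamma_cvg : gamma_ n @[n --> \oo] --> gamma.
Let a n : R := 1 + gamma_ n / n%:R.

(** The quantity is at most |gamma_n - gamma| + gamma^2 e^|gamma| / n, the last term being the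
    second-order remainder of the exponential. *)
Lemma near_critical_expR : n%:R * `|a n - expR (gamma * n%:R^-1)| @[n --> \oo] --> (0 : R).
Proof.
apply/cvgrPdist_le => e e0; have e20 : 0 < e / 2 by rewrite divr_gt0.
have C0 : 0 < gamma ^+ 2 * expR `|gamma| + 1.
  by rewrite ltr_wpDl// mulr_ge0 ?sqr_ge0// expR_ge0.
have e3 : 0 < e / 2 / (gamma ^+ 2 * expR `|gamma| + 1) by rewrite divr_gt0.
move/cvgrPdist_le : gamma_cvg => /(_ _ e20).
move/cvgrPdist_le : cvg_invn => /(_ _ e3).
have : \forall n \near \oo, (0 < n)%N by exists 1%N.
apply: filterS3 => n n0; rewrite !sub0r !normrN ger0_norm ?invr_ge0//.
have nR : 0 < n%:R :> R by rewrite ltr0n.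
have nR0 : n%:R != 0 :> R by rewrite gt_eqF.
rewrite (ger0_norm (_ : 0 <= n%:R * _)) ?mulr_ge0// => hn hg.
have -> : a n - expR (gamma * n%:R^-1) = (gamma_ n - gamma) / n%:R -
    (expR (gamma * n%:R^-1) - 1 - gamma * n%:R^-1) by rewrite /a; ring.
apply: (@le_trans _ _ (n%:R * (`|gamma_ n - gamma| / n%:R +
    (gamma * n%:R^-1) ^+ 2 * expR `|gamma|))).
  rewrite ler_wpM2l//; apply: le_trans (ler_normB _ _) _; apply: lerD.
    by rewrite normrM normfV (ger0_norm (ler0n _ n)).
  apply: le_trans (expR_taylor1_le _) _; rewrite ler_wpM2l ?sqr_ge0// ler_expR.
  rewrite normrM ler_piMr// ger0_norm ?invr_ge0// invf_le1// ler1n//.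
have -> : n%:R * (`|gamma_ n - gamma| / n%:R + (gamma * n%:R^-1) ^+ 2 * expR `|gamma|) =
  `|gamma_ n - gamma| + n%:R^-1 * (gamma ^+ 2 * expR `|gamma|) by field.
rewrite (splitr e); apply: lerD; first by rewrite distrC.
move: hn; rewrite ler_pdivlMr// => hn; apply: le_trans hn.
by rewrite ler_wpM2l ?invr_ge0// lerDl.
Qed.

Lemma near_critical_error (A B C D K : R) :
  A * (K * B * (n%:R * `|a n - expR (gamma * n%:R^-1)| * C +
    `|gamma| * n%:R^-1 * expR (`|gamma| * n%:R^-1)) + D * n%:R^-1) @[n --> \oo] --> (0 : R).
Proof.
have e1 : expR (`|gamma| * n%:R^-1) @[n --> \oo] --> (1 : R).
  suff : expR (`|gamma| * n%:R^-1) @[n --> \oo] --> expR (`|gamma| * 0).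
    by rewrite mulr0 expR0.
  apply: continuous_cvg; first exact: continuous_expR.
  by apply: cvgMl_tmp; exact: cvg_invn.
rewrite [X in _ --> X](_ : 0 = A * (K * B * (0 * C + `|gamma| * 0 * 1) + D * 0)).
  2: by ring.
apply: cvgMl_tmp; apply: cvgD; last by apply: cvgMl_tmp; exact: cvg_invn.
apply: cvgMl_tmp; apply: cvgD; first by apply: cvgMr_tmp; exact: near_critical_expR.
by apply: cvgM => //; apply: cvgMl_tmp; exact: cvg_invn.
Qed.

(** With x = c/n <= 1/2, both 1 + x and 1/(1 - x) are at most 1 + 2 x <= e^(2x); at most n K factors
    then give e^(2cK). *)
Lemma near_critical_power (c K : R) n : (0 < n)%N -> 0 <= c -> 0 <= K ->
  `|gamma_ n| <= c -> 2 * c <= n%:R ->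
  0 < a n /\ forall k, k%:R <= n%:R * K ->
    a n ^+ k <= expR (2 * c * K) /\ a n ^- k <= expR (2 * c * K).
Proof.
move=> n0 c0 K0 gc cn; have nR : 0 < n%:R :> R by rewrite ltr0n.
set x := c / n%:R.
have x0 : 0 <= x by rewrite divr_ge0.
have x1 : 2 * x <= 1 by rewrite mulrA ler_pdivrMr// mul1r.
have gx : `|gamma_ n / n%:R| <= x.
  by rewrite normrM normfV (ger0_norm (ler0n _ n)) ler_pM2r ?invr_gt0.
have /andP[gx1 gx2] : - x <= gamma_ n / n%:R <= x by rewrite -ler_norml.
have a0 : 0 < a n by rewrite /a; lra.
have ax : a n <= expR (2 * x).
  by apply: le_trans (expR_ge1Dx (2 * x)); rewrite /a; lra.
have aVx : (a n)^-1 <= expR (2 * x).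
  rewrite -div1r ler_pdivrMr//.
  apply: (@le_trans _ _ ((1 + 2 * x) * (1 - x))).
    rewrite -subr_ge0; have -> : (1 + 2 * x) * (1 - x) - 1 = x * (1 - 2 * x) by ring.
    by rewrite mulr_ge0// subr_ge0.
  by apply: ler_pM; [lra|lra|exact: expR_ge1Dx|rewrite /a; lra].
split => // k kK.
have ek : expR (2 * x) ^+ k <= expR (2 * c * K).
  rewrite -expRM_natl ler_expR /x.
  have -> : k%:R * (2 * (c / n%:R)) = 2 * c * (k%:R / n%:R) by ring.
  by rewrite ler_wpM2l ?mulr_ge0// ler_pdivrMr// mulrC.
split; apply: le_trans ek.
  by rewrite lerXn2r ?nnegrE ?expR_ge0// ltW.
by rewrite -exprVn lerXn2r ?nnegrE ?expR_ge0// invr_ge0 ltW.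
Qed.

End near_critical_offspring_mean.

(** * Convergence of the scaled processes *)

Lemma limn_esup_near (R : realType) (u : nat -> \bar R) (l e : R) : 0 < e ->
  (limn_esup u <= l%:E)%E -> \forall n \near \oo, (u n <= (l + e)%:E)%E.
Proof.
move=> e0 ul; have : (limn_esup u < (l + e)%:E)%E.
  by apply: le_lt_trans ul _; rewrite lte_fin ltrDl.
rewrite /limn_esup /limf_esup => /ereal_inf_lt[_ [A nA <-] Al].
apply: filterS nA => n An; apply: le_trans (ltW Al).
by apply: ereal_sup_ubound; exists n.
Qed.

Section offspring_moments.
Context d (Omega : measurableType d) (R : realType) (P : probability Omega R).
Variables (xi : {RV P >-> nat}) (a : R).
Hypothesis xi_mean : 'E_P[fun w => (xi w)%:R%R]%E = a%:E.

Lemma offspring_mean : (\int[distribution P xi]_x (x%:R)%:E = a%:E)%E.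
Proof.
rewrite ge0_integral_distribution//.
by rewrite -xi_mean unlock.
Qed.

Lemma offspring_variance : (\int[distribution P xi]_x ((x%:R - a) ^+ 2)%:E =
  'V_P[fun w => (xi w)%:R%R])%E.
Proof.
rewrite ge0_integral_distribution//; last by move=> x; rewrite lee_fin sqr_ge0.
rewrite /variance [in RHS]unlock xi_mean [in RHS]unlock.
by apply: eq_integral => w _ /=; rewrite expr2.
Qed.

End offspring_moments.

Section step_random_element.
Context d (Omega : measurableType d) (R : realType).
Variables (n : nat) (Y X : nat -> Omega -> nat) (r s : R).
Hypothesis mY : forall k, measurable_fun setT (Y k).
Hypothesis mX : forall k, measurable_fun setT (X k).

Lemma step_path2_measurable : measurable_fun setT
  (fun w => step_path n (fun k => colvec2 (r * (Y k w)%:R) (s * (X k w)%:R))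
    : borel (skorokhod 'cV[R]_2)).
Proof.
apply: (@step_path_measurable R 'cV[R]_2 _ Omega (nat * nat)%type n
  (fun p => colvec2 (r * p.1%:R) (s * p.2%:R)) (fun k w => (Y k w, X k w))) => k [i j].
have -> : (fun w => (Y k w, X k w)) @^-1` [set (i, j)] =
    (Y k @^-1` [set i]) `&` (X k @^-1` [set j]).
  by apply/seteqP; split=> w /= [-> ->].
apply: measurableI; rewrite -[X in measurable X]setTI; first exact: mY.
exact: mX.
Qed.

End step_random_element.

Lemma sup_step_measurable d (Omega : measurableType d) (R : realType)
    (Y : nat -> Omega -> nat) (r A : R) N :
  (forall k, measurable_fun setT (Y k)) ->
  measurable [set w | exists2 k, (k <= N)%N & A < r * (Y k w)%:R].
Proof.
move=> mY.
have -> : [set w | exists2 k, (k <= N)%N & A < r * (Y k w)%:R] =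
    \bigcup_(k in `I_N.+1) ((fun w => r * (Y k w)%:R : R) @^-1` `]A, +oo[).
  apply/seteqP; split=> w [k kN Ak]; exists k => //.
    by rewrite /= in_itv/= andbT.
  by move: Ak; rewrite /= in_itv/= andbT.
apply: bigcup_measurable => k _; rewrite -[X in measurable X]setTI.
by apply: (measurable_fun_nat (fun i => r * i%:R : R) (mY k)).
Qed.

Lemma integral_le_scaled_expectation d (Omega : measurableType d) (R : realType)
    (P : probability Omega R) (Y : {RV P >-> nat}) (r l : R) : 0 < r ->
  ('E_P[fun w => (r^-1 * (Y w)%:R)%R] <= l%:E)%E ->
  (\int[P]_w ((Y w)%:R)%:E <= (r * l)%:E)%E.
Proof.
move=> r0; rewrite unlock => h.
have {}h : (r^-1%:E * \int[P]_w ((Y w)%:R)%:E <= l%:E)%E.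
  rewrite -ge0_integralZl//.
    apply/measurable_EFinP.
    exact: (measurable_fun_nat (fun i => i%:R : R) (measurable_funPT Y)).
  by rewrite lee_fin invr_ge0 ltW.
by rewrite lee_pdivrMl// -EFinM in h.
Qed.

Section GW_scaled_deviation.
Context d (Omega : measurableType d) (R : realType) (P : probability Omega R)
  (xi : nat -> nat -> {RV P >-> nat}) (Y : nat -> {RV P >-> nat})
  (X : nat -> Omega -> nat).
Hypothesis GW : GW_immigration xi Y X.
Variables (n : nat) (m g v : R).
Let a := 1 + g / n%:R.
Hypothesis xi_mean : (\int[distribution P (xi 1 1)]_x (x%:R)%:E = a%:E)%E.
Hypothesis xi_var : (\int[distribution P (xi 1 1)]_x ((x%:R - a) ^+ 2)%:E = v%:E)%E.
Variables (gamma K c A M e : R).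
Hypotheses (n0 : (0 < n)%N) (m0 : 0 < m) (K0 : 0 < K) (c0 : 0 <= c)
  (M0 : 0 <= M) (e0 : 0 < e).
Hypotheses (gc : `|g| <= c) (cn : 2 * c <= n%:R).
Let B := expR (2 * c * K).
Let E := expR (`|gamma| * K).
Hypothesis Ymean : forall k, k%:R <= n%:R * K ->
  (\int[P]_w ((Y k w)%:R)%:E <= (m * M)%:E)%E.
Hypothesis error : A * (K * B * (n%:R * `|a - expR (gamma * n%:R^-1)| * (E * K) +
    `|gamma| * n%:R^-1 * expR (`|gamma| * n%:R^-1)) +
    E ^+ 2 * (1 + `|gamma| * K) * n%:R^-1) <= e / 2.

Lemma GW_scaled_deviation : exists bad : set Omega,
  [/\ measurable bad, (P bad <= (4 * K ^+ 2 * B ^+ 5 * M / e ^+ 2 * (v / m))%:E)%E &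
   forall w, ~ bad w -> (forall k, k%:R <= n%:R * K -> m^-1 * (Y k w)%:R <= A) ->
   forall t, 0 <= t <= K ->
     `|(n%:R * m)^-1 * (X (Num.truncn (n%:R * t)) w)%:R -
       exp_conv gamma (step_path n (fun k => m^-1 * (Y k w)%:R)) t| <= e].
Proof.
have nR : 0 < n%:R :> R by rewrite ltr0n.
have nK0 : 0 <= n%:R * K by rewrite mulr_ge0// ltW.
have [a0 aB] := near_critical_power (gamma_ := fun=> g) n0 c0 (ltW K0) gc cn.
rewrite -/a -/B in a0 aB.
have B1 : 1 <= B by rewrite /B -expR0 ler_expR !mulr_ge0// ltW.
have B0 : 0 < B by exact: expR_gt0.
have v0 : 0 <= v.
  by rewrite -lee_fin -xi_var; apply: integral_ge0 => x _; rewrite lee_fin sqr_ge0.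
pose N := Num.truncn (n%:R * K).
have NnK : N%:R <= n%:R * K by rewrite /N truncn_le.
have leN k : (k <= N)%N -> k%:R <= n%:R * K.
  by move=> kN; apply: le_trans NnK; rewrite ler_nat.
(* Chosen so that B c1, divided by n m, is e/2; [error] supplies the other half. The factor B^2 in
   1/c1^2 accounts for B^5 in the probability bound. *)
pose c1 := n%:R * m * e / (2 * B).
have c10 : 0 < c1 by rewrite divr_gt0 ?mulr_gt0.
have [||||bad [mbad Pbad hbad]] := @GW_deviation _ _ R P xi Y X GW a v xi_mean xi_var
  N B (m * M) a0 _ _ _ _ c1 c10.
- by move=> k kN; have [] := aB k (leN k kN).
- by move=> k kN; have [] := aB k (leN k kN).
- by rewrite mulr_ge0// ltW.
- by move=> k kN; apply: Ymean; apply: leN; exact: ltnW.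
exists bad; split => //.
  apply: le_trans Pbad _; rewrite lee_fin.
  apply: (@le_trans _ _ ((n%:R * K) ^+ 2 * B ^+ 3 * v * (m * M) / c1 ^+ 2)).
    rewrite ler_wpM2r ?invr_ge0 ?sqr_ge0// ler_wpM2r ?mulr_ge0// ?(ltW m0)//.
    rewrite ler_wpM2r// ler_wpM2r ?exprn_ge0 ?(ltW B0)//.
    by rewrite lerXn2r ?nnegrE.
  rewrite le_eqVlt; apply/orP; left; apply/eqP; rewrite /c1; field.
  by rewrite !gt_eqF.
move=> w wb YA t /andP[t0 tK].
set k := Num.truncn (n%:R * t).
have kN : (k <= N)%N by apply: le_truncn; rewrite ler_pM2l.
have yA i : i%:R <= n%:R * K -> `|m^-1 * (Y i w)%:R| <= A.
  by move=> iK; rewrite ger0_norm ?mulr_ge0 ?invr_ge0 ?(ltW m0)//; exact: YA.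
have t0K : 0 <= t <= K by rewrite t0.
have h1 := linear_recursion_exp_conv gamma n0 a0 B1 K0 (fun i iK => (aB i iK).1) yA t0K.
have h2 := hbad w wb k kN.
move: h1; rewrite linear_recursionZ -/k -/E => h1.
set z := linear_recursion _ _ _ in h1 h2.
rewrite -(subrK ((n%:R * m)^-1 * z) ((n%:R * m)^-1 * _)) -addrA.
apply: le_trans (ler_normD _ _) _; rewrite (splitr e); apply: lerD.
  rewrite -mulrBr normrM gtr0_norm ?invr_gt0 ?mulr_gt0//.
  rewrite ler_pdivrMl ?mulr_gt0//; apply: le_trans h2 _.
  rewrite le_eqVlt; apply/orP; left; apply/eqP; rewrite /c1; field.
  by rewrite gt_eqF.
apply: le_trans error.
have -> : (n%:R * m)^-1 * z = n%:R^-1 * (m^-1 * z) by rewrite invfM mulrA.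
exact: h1.
Qed.

End GW_scaled_deviation.

Theorem theorem3p3 (R : realType) (d : measure_display)
    (Omega : measurableType d) (P : probability Omega R)
    (m : nat -> R)
    (xi : nat -> nat -> nat -> {RV P >-> nat})
    (Y : nat -> nat -> {RV P >-> nat})
    (X : nat -> nat -> Omega -> nat)
    (Ylim : R -> Omega -> R)
    (gamma_ : nat -> R) (gamma : R)
    (m_gt0 : forall n, (0 < n)%N -> 0 < m n)
    (X_GW : forall n, (0 < n)%N -> GW_immigration (xi n) (Y n) (X n))
    (xi_mean : forall n, (0 < n)%N ->
      ('E_P[fun w => (xi n 1%N 1%N w)%:R%R] < +oo)%E)
    (Y_mean : forall n k, (0 < n)%N -> ('E_P[fun w => (Y n k w)%:R%R] < +oo)%E)
    (Y_mean_bound : exists L : R -> R, cadlag L /\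
      forall t : R, 0 <= t ->
        (limn_esup (fun n => ereal_sup
           [set 'E_P[fun w => ((m n)^-1 * (Y n (Num.truncn (n%:R * s)) w)%:R)%R]
           | s in `[0%R, t]%classic]) <= (L t)%:E)%E)
    (Ylim_meas : forall t, 0 <= t -> measurable_fun [set: Omega] (Ylim t))
    (Ylim_ge0 : forall t w, 0 <= t -> 0 <= Ylim t w)
    (Ylim_cadlag : forall w, cadlag (Ylim ^~ w))
    (Y_cvg : cvg_in_law P
      (fun n t w => (m n)^-1 * (Y n (Num.truncn (n%:R * t)) w)%:R) Ylim)
    (xi_moment2 : forall n, (0 < n)%N ->
      ('E_P[fun w => ((xi n 1%N 1%N w)%:R ^+ 2)%R] < +oo)%E)
    (xi_var : ((m n)^-1%:E * 'V_P[fun w => (xi n 1%N 1%N w)%:R%R])%E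
      @[n --> \oo] --> 0%E)
    (gamma_cvg : gamma_ n @[n --> \oo] --> gamma)
    (xi_meanE : forall n, (0 < n)%N ->
      'E_P[fun w => (xi n 1%N 1%N w)%:R%R]%E = (1 + gamma_ n / n%:R)%:E) :
  cvg_in_law P
    (fun n t w => colvec2
      ((m n)^-1 * (Y n (Num.truncn (n%:R * t)) w)%:R)
      ((n%:R * m n)^-1 * (X n (Num.truncn (n%:R * t)) w)%:R))
    (fun t w => colvec2
      (Ylim t w)
      (\int[lebesgue_measure]_(s in `[0, t]) (expR (gamma * (t - s)) * Ylim s w))).
Proof.
have [XY_ [XYl [pY pYl wY]]] := Y_cvg.
pose r n : R := (m n)^-1.
pose s n : R := (n%:R * m n)^-1.
have mY n k : measurable_fun setT (Y n k : Omega -> nat) by exact: (measurable_funPT (Y n k)).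
have mX n k : (0 < n)%N -> measurable_fun setT (X n k) by move=> /X_GW /GW_measurable; exact.
(* Index 0 is outside the model, so a default path stands there. *)
have mA n : measurable_fun setT (fun w => (if n is 0%N then point else
    step_path n (fun k => colvec2 (r n * (Y n k w)%:R) (s n * (X n k w)%:R)))
    : borel (skorokhod 'cV[R]_2)).
  case: n => [|n]; first exact: measurable_cst.
  by apply: step_path2_measurable => // k; exact: mX.
have mPhi : measurable_fun setT (exp_conv_graph gamma :
    borel (skorokhod R) -> borel (skorokhod 'cV[R]_2)).
  apply: measurable_fun_skorokhod => F cF; apply: continuous_borel_measurable.
  apply: J1_cvg_continuous => f_ f ff.
  exact: (continuous_J1_cvg cF (exp_conv_graph_J1_cvg gamma ff)).
have mB (Z : {RV P >-> borel (skorokhod R)}) : measurable_fun setT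
    (exp_conv_graph gamma \o Z : Omega -> borel (skorokhod 'cV[R]_2)).
  exact: measurableT_comp.
pose A_ n : {RV P >-> borel (skorokhod 'cV[R]_2)} := mfun_Sub (mem_set (mA n)).
pose B (Z : {RV P >-> borel (skorokhod R)}) : {RV P >-> borel (skorokhod 'cV[R]_2)} :=
  mfun_Sub (mem_set (mB Z)).
exists A_, (B XYl); split.
- by case=> // n _ w t t0.
- move=> w t t0 /=; rewrite pYl//; congr colvec2.
  apply: eq_Rintegral => u; rewrite inE /= in_itv/= => /andP[u0 _].
  by rewrite pYl.
apply: (@weak_cvg_converging_together _ _ _ _ _ A_ (fun n => B (XY_ n))).
  apply/weak_cvgP => F M cF FM.
  move/weak_cvgP : wY => /(_ (F \o exp_conv_graph gamma) M); apply; last by move=> f; exact: FM.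
  apply: J1_cvg_continuous => f_ f ff.
  exact: (continuous_J1_cvg cF (exp_conv_graph_J1_cvg gamma ff)).
move=> e e0.
(* At scale e the distance inspects only the times up to 1/e. *)
pose K := e^-1; have K0 : 0 < K by rewrite invr_gt0.
have e20 : 0 < e / 2 by rewrite divr_gt0.
have [A A0 tight] := weak_cvg_tight_sup K wY e20.
have [L [_ YL]] := Y_mean_bound.
pose c := `|gamma| + 1; have c0 : 0 <= c by rewrite addr_ge0.
pose Bd := expR (2 * c * K).
have Bd1 : 1 <= Bd by rewrite /Bd -expR0 ler_expR !mulr_ge0// ltW.
pose Ly := `|L K| + 1; have Ly0 : 0 < Ly by rewrite ltr_wpDl.
pose C := 4 * K ^+ 2 * Bd ^+ 5 * Ly / e ^+ 2.
have C1 : 0 <= C.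
  apply: divr_ge0; last exact: sqr_ge0.
  apply: mulr_ge0; last exact: ltW.
  apply: mulr_ge0; last by rewrite exprn_ge0// (le_trans _ Bd1).
  by apply: mulr_ge0 => //; exact: sqr_ge0.
have C0 : 0 < C + 1 by rewrite ltr_wpDl.
pose E := expR (`|gamma| * K).
have hc : \forall n \near \oo, `|gamma_ n| <= c.
  move/cvgrPdist_le : gamma_cvg => /(_ _ ltr01); apply: filterS => n.
  rewrite distrC => gn; rewrite /c -(subrK gamma (gamma_ n)) addrC.
  by apply: le_trans (ler_normD _ _) _; rewrite lerD2l.
have hn : \forall n \near \oo, 2 * c <= n%:R.
  exists (Num.truncn (2 * c)).+1 => // n /= cn.
  by apply: (le_trans (ltW (truncnS_gt _))); rewrite ler_nat.
have herr := near_critical_error gamma_cvg A Bd (E * K) (E ^+ 2 * (1 + `|gamma| * K)) K.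
move/cvgrPdist_le : herr => /(_ _ e20) herr.
have hmean := limn_esup_near ltr01 (YL K (ltW K0)).
move/fine_cvgP : xi_var => [Vfin /cvgrPdist_le hvar].
have eC0 : 0 < e / 2 / (C + 1) by rewrite divr_gt0.
have {}hvar := hvar _ eC0.
have AE n w : (0 < n)%N -> A_ n w = step_path n
    (fun k => colvec2 (r n * (Y n k w)%:R) (s n * (X n k w)%:R)) by case: n.
near=> n.
have n0 : (0 < n)%N by near: n; exists 1%N.
have nR : 0 < n%:R :> R by rewrite ltr0n.
have m0 := m_gt0 _ n0.
pose v := fine 'V_P[fun w => (xi n 1%N 1%N w)%:R%R]%E.
have vE : 'V_P[fun w => (xi n 1%N 1%N w)%:R%R]%E = v%:E.
  have : ((m n)^-1%:E * 'V_P[fun w => (xi n 1%N 1%N w)%:R%R])%E \is a fin_num by near: n.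
  rewrite /v; case: ('V_P[_])%E => //; rewrite ?gt0_muley ?gt0_muleNy// lte_fin invr_gt0//.
have hv : (m n)^-1 * v <= e / 2 / (C + 1).
  have : `|0 - fine ((m n)^-1%:E * 'V_P[fun w => (xi n 1%N 1%N w)%:R%R])%E| <=
      e / 2 / (C + 1) by near: n; exact: hvar.
  by rewrite vE -EFinM sub0r normrN; apply: le_trans; exact: ler_norm.
have Ymean k : k%:R <= n%:R * K -> (\int[P]_w ((Y n k w)%:R)%:E <= (m n * Ly)%:E)%E.
  move=> kK; have : (ereal_sup [set 'E_P[fun w => ((m n)^-1 *
      (Y n (Num.truncn (n%:R * s)) w)%:R)%R] | s in `[0%R, K]%classic] <= (L K + 1)%:E)%E.
    by near: n.
  have kn : n%:R * (k%:R / n%:R) = k%:R :> R by rewrite mulrCA mulfV ?mulr1// gt_eqF.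
  have kI : `[0, K]%classic (k%:R / n%:R : R).
    by rewrite /= in_itv/= divr_ge0//= ler_pdivrMr// mulrC.
  move=> /(le_trans (ereal_sup_ubound (ex_intro2 _ _ _ kI erefl))).
  rewrite kn natrK => /(integral_le_scaled_expectation m0) /le_trans; apply.
  by rewrite lee_fin ler_wpM2l ?(ltW m0)// lerD2r ler_norm.
have gcn : `|gamma_ n| <= c by near: n; exact: hc.
have cn : 2 * c <= n%:R by near: n; exact: hn.
have err : A * (K * Bd * (n%:R * `|1 + gamma_ n / n%:R - expR (gamma * n%:R^-1)| * (E * K) +
    `|gamma| * n%:R^-1 * expR (`|gamma| * n%:R^-1)) +
    E ^+ 2 * (1 + `|gamma| * K) * n%:R^-1) <= e / 2.
  by apply: le_trans (ler_norm _) _; rewrite -normrN -sub0r; near: n; exact: herr.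
have [bad1 [mbad1 Pbad1 hbad1]] := GW_scaled_deviation (X_GW _ n0)
  (offspring_mean (xi_meanE _ n0)) (etrans (offspring_variance (xi_meanE _ n0)) vE)
  n0 m0 K0 c0 (ltW Ly0) e0 gcn cn Ymean err.
pose N := Num.truncn (n%:R * K).
(* Phrased with grid indices this is a finite union of measurable events; an excess at index k is an
   excess of the path at time k/n, as the tightness bound requires. *)
pose bad2 := [set w | exists2 k, (k <= N)%N & A < (m n)^-1 * (Y n k w)%:R].
have mbad2 : measurable bad2 by exact: sup_step_measurable.
have leN k : k%:R <= n%:R * K -> (k <= N)%N.
  by move=> kK; rewrite truncn_ge_nat// mulr_ge0// ltW.
have Pbad2 : fine (P bad2) <= e / 2.
  have tightn : forall E : set Omega, measurable E ->
      (forall w, E w -> exists2 t, 0 <= t <= K & A < `|XY_ n w t|) ->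
      fine (P E) <= e / 2 by near: n; exact: tight.
  apply: tightn => // w [k kN Ak]; exists (k%:R / n%:R).
    rewrite divr_ge0//= ler_pdivrMr// mulrC.
    apply: (@le_trans _ _ N%:R); first by rewrite ler_nat.
    by rewrite truncn_le mulr_ge0// ltW.
  rewrite (pY _ n0) ?divr_ge0// mulrCA mulfV ?gt_eqF// mulr1 natrK.
  exact: lt_le_trans Ak (ler_norm _).
exists (bad1 `|` bad2); split; first exact: measurableU.
  have Pb1 : fine (P bad1) <= e / 2.
    rewrite -lee_fin fineK ?fin_num_measure//; apply: le_trans Pbad1 _.
    rewrite lee_fin -/Bd -/C mulrC [v / _]mulrC.
    apply: (@le_trans _ _ (e / 2 / (C + 1) * C)); first by rewrite ler_wpM2r.
    by rewrite -mulrA ler_piMr ?(ltW e20)// mulrC ler_pdivrMr// mul1r lerDl.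
  apply: (@le_trans _ _ (fine (P bad1 + P bad2))).
    apply: fine_le; rewrite ?fin_numD ?fin_num_measure//; first exact: measurableU.
    exact: measureU2.
  by rewrite fineD ?fin_num_measure// (splitr e) lerD.
move=> w wb; apply: J1_dist_uniform => // t t0 te.
have tK : t <= K by rewrite /K -div1r ler_pdivlMr.
rewrite AE//; apply: colvec2_dist_le.
  by rewrite (pY _ n0)// /r subrr normr0 ltW.
(* [XY_ n w] is identified with the scaled immigration at non-negative times, which are the only
   ones in the integral. *)
have -> : exp_conv gamma (XY_ n w) t =
    exp_conv gamma (step_path n (fun k => (m n)^-1 * (Y n k w)%:R)) t.
  apply: eq_Rintegral => u; rewrite inE /= in_itv/= => /andP[u0 _].
  by rewrite (pY _ n0).
apply: hbad1; last by rewrite t0.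
  by move=> b; apply: wb; left.
move=> k kK; rewrite leNgt; apply/negP => Ak; apply: wb; right.
by exists k => //; exact: leN.
Unshelve. all: by end_near. Qed.
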